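(* Let $\epsilon>0$ be a constant and consider Boolean functions $f\colon\{0,1\}^n\to\{0,1\}$ (for the asymptotic items, a family $(f_n)_n$). (1) If $\mathrm{Cor}(f,16)\le 2^{-n(1-\epsilon)}$, then $s(f)\ge 3.9(1-\epsilon)n-4$. (2) If for every constant integer $d$, $\mathrm{Cor}(f_n,d)\le 2^{-\epsilon n}$ for all sufficiently large $n$ (i.e. $\mathrm{Cor}(f,\omega(1))\le 2^{-\epsilon n}$), then $s_{\mathrm{sp}}(f)=\omega(n)$. (3) If for every constant $\eta>0$, $\mathrm{Cor}(f_n,2^{(\log n)^{1-\eta}})\le 2^{-\epsilon n}$ for all sufficiently large $n$ (i.e. $\mathrm{Cor}(f,2^{(\log n)^{1-o(1)}})\le 2^{-\epsilon n}$), then $s_{\log}(f)=\omega(n)$. (4) If for every constant $C>0$, $\mathrm{Cor}(f_n,n^{\epsilon})\le 2^{-Cn/\log\log n}$ for all sufficiently large $n$ (i.e. $\mathrm{Cor}(f,n^\epsilon)\le 2^{-\omega(n/\log\log n)}$), then $s_{\log}(f)=\omega(n)$.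
   Context: For $f,g\colon\{0,1\}^n\to\{0,1\}$, $\mathrm{Cor}(f,g)=|\Pr_x[f(x)=g(x)]-\Pr_x[f(x)\ne g(x)]|$ with $x$ uniform, and $\mathrm{Cor}(f,d)=\max_g\mathrm{Cor}(f,g)$ over polynomials $g$ over $\mathbb{F}_2$ of degree at most $d$. Circuits are Boolean circuits over all binary Boolean operations (fan-in 2), with size = number of internal gates; $s(f)$ is the minimum size of a circuit computing $f$. $s_{\mathrm{sp}}(f)=\omega(n)$ means: for every constant $c$, for all large $n$, $f_n$ has no series-parallel circuit of size at most $cn$, where a circuit is series-parallel if its underlying DAG $(V,E)$ has a labeling $\ell\colon V\to\mathbb{N}$ with $\ell(u)<\ell(v)$ for every edge $(u,v)$ and with no two edges $(u,v),(u',v')$ satisfying $\ell(u)<\ell(u')<\ell(v)<\ell(v')$. $s_{\log}(f)=\omega(n)$ means: for every constant $c$, for all large $n$, $f_n$ has no circuit of size at most $cn$ and depth at most $c\log n$. *)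

(* Defs.v *)
From HB Require Import structures.
From mathcomp Require Import all_boot all_order all_algebra.
From mathcomp Require Import all_classical all_reals all_analysis.
(* The notations of [mpoly] clash with those of [analysis]. *)
From mathcomp Require Import -(notations) mpoly.

Set Implicit Arguments.
Unset Strict Implicit.
Unset Printing Implicit Defensive.

Import Order.TTheory GRing.Theory Num.Theory.

Local Open Scope classical_set_scope.
Local Open Scope ring_scope.

Definition boolfun (n : nat) := n.-tuple bool -> bool.

Definition log2 (R : realType) (x : R) : R := ln x / ln 2.

Section Correlation.
Variables (R : realType) (n : nat).
Implicit Types f g : boolfun n.

Definition Pr (P : pred (n.-tuple bool)) : R :=
  #|[set x | P x]%SET|%:R / #|{: n.-tuple bool}|%:R.

Definition Cor f g : R :=
  `|Pr (fun x => f x == g x) - Pr (fun x => f x != g x)|.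

(* [msize p] is the total degree of [p] plus one, and 0 if [p = 0]. *)
Definition mpoly_degree (p : mpoly.mpoly n 'F_2) : nat :=
  (mpoly.msize p).-1.

Definition represents (p : mpoly.mpoly n 'F_2) g : Prop :=
  forall x : n.-tuple bool,
    meval (fun i => (tnth x i)%:R) p = (g x)%:R :> 'F_2.

(* The degree bound [d] is a real number, since bounds such as [n `^ eps] are
   not integers. The neutral element 0 is harmless: correlations are
   nonnegative, and the range is nonempty when [0 <= d]. *)
Definition Cor_deg f (d : R) : R :=
  \big[Num.max/0]_(g : {ffun n.-tuple bool -> bool} |
      `[< exists p, (mpoly_degree p)%:R <= d /\ represents p g >]) Cor f g.

End Correlation.

Arguments Cor_deg {R n} f d.

Record gate := Gate {
  gate_op : bool -> bool -> bool;
  gate_l : nat;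
  gate_r : nat }.

(* Vertices are numbered in a topological order: [0, ..., n - 1] are the inputs
   and [n + i] is the gate at position [i] of [gates]. *)
Record circuit (n : nat) := Circuit {
  gates : seq gate;
  output : nat;
  gates_acyclic : forall i g, onth gates i = Some g ->
    (gate_l g < n + i)%N /\ (gate_r g < n + i)%N;
  output_lt : (output < n + size gates)%N }.

Section Circuits.
Variable n : nat.
Implicit Types (C : circuit n) (f : boolfun n).

Definition circuit_size C : nat := size (gates C).

Definition circuit_values C (x : n.-tuple bool) : seq bool :=
  foldl (fun vs g => rcons vs
           (gate_op g (nth false vs (gate_l g)) (nth false vs (gate_r g))))
        x (gates C).

Definition circuit_eval C (x : n.-tuple bool) : bool :=
  nth false (circuit_values C x) (output C).

Definition computes C f : Prop := circuit_eval C =1 f.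

(* Entry [v] is the length of a longest path from an input to vertex [v]. *)
Definition circuit_depths C : seq nat :=
  foldl (fun ds g => rcons ds
           (maxn (nth 0 ds (gate_l g)) (nth 0 ds (gate_r g))).+1)%N
        (nseq n 0%N) (gates C).

Definition circuit_depth C : nat := nth 0%N (circuit_depths C) (output C).

Definition vertex C := 'I_(n + circuit_size C).

Definition edge C (u v : vertex C) : Prop :=
  exists i g, [/\ onth (gates C) i = Some g, (v : nat) = (n + i)%N
                & (u : nat) = gate_l g \/ (u : nat) = gate_r g].

Definition series_parallel C : Prop :=
  exists l : vertex C -> nat,
    (forall u v, edge u v -> (l u < l v)%N) /\
    ~ (exists u v u' v', [/\ edge u v, edge u' v' &
         [/\ (l u < l u')%N, (l u' < l v)%N & (l v < l v')%N]]).

(* An infimum of natural numbers, hence a minimum; it is +oo only if no circuit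
   computes [f], which happens only for [n = 0] (constants are not sources). *)
Definition min_circuit_size (R : realType) f : \bar R :=
  ereal_inf [set ((circuit_size C)%:R)%:E | C in [set C | computes C f]].

End Circuits.

Definition ssp_superlinear (R : realType) (f : forall n, boolfun n) : Prop :=
  forall c : R, \forall n \near \oo,
    ~ exists C : circuit n, [/\ computes C (f n), series_parallel C
        & (circuit_size C)%:R <= c * n%:R].

Definition slog_superlinear (R : realType) (f : forall n, boolfun n) : Prop :=
  forall c : R, \forall n \near \oo,
    ~ exists C : circuit n, [/\ computes C (f n),
        (circuit_size C)%:R <= c * n%:R
      & (circuit_depth C)%:R <= c * log2 n%:R].

(* Main.v *)
(**
Guess the values of a few gates of a circuit for [f], each of which is, given the
previous guesses, a polynomial of degree at most [d] in the inputs. A leaf of the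
guessing tree is a set [S] cut out by such polynomials, its indicator function is
an average of signs of polynomials of degree at most [d], and if [f] has degree at
most [d] on [S] then [#|S| <= 2 ^ n * Cor(f, d)]. Hence a tree with [L] leaves
gives [1 <= L * Cor(f, d)].

(1) A guess simplifies the circuit. A sum with two users and a gate among its
inputs kills 4 gates: itself, two users, and one summand. A product with two users
and a gate among its inputs kills 4 gates, or 3 and 5 depending on the guess, since
one of the values determines both factors. A gate with two private predecessor
gates kills 4. If no such gate of degree at most 16 exists, every gate has degree
at most 6. So [L <= 2 ^ ((s + 4) / 3.9)].

(2) The label intervals of the edges are laminar, so every interval can be split at
a point over which no edge jumps. Remove the edges whose number of left turns, or
of right turns, in the resulting binary tree is [i] modulo [K]. A path over an
interval splits into paths over its two halves; as the last edge of a path to the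
right end has made no further left turn, and the first edge of a path from the left
end no further right turn, an induction on the distances of the two counters to [i]
bounds the length of the remaining paths in terms of [K]. A suitable [i] removes a
fraction [2 / K] of the edges.

(3), (4) Delete one digit of the depths written in base [B], and remove the edges
whose endpoints first differ in this digit.
*)

Require Import Defs.
From HB Require Import structures.
From mathcomp Require Import all_boot all_order all_algebra.
From mathcomp Require Import all_classical all_reals all_analysis.
From mathcomp Require Import -(notations) mpoly.
From mathcomp Require Import zify ring lra.

Set Implicit Arguments.
Unset Strict Implicit.
Unset Printing Implicit Defensive.

Import Order.TTheory GRing.Theory Num.Theory.

Local Open Scope classical_set_scope.
Local Open Scope ring_scope.

(** * Correlation with low-degree polynomials *)

Section LowDegree.
Variable n : nat.
Local Notation X := (n.-tuple bool).
Implicit Types (h : X -> bool) (d : nat) (S : pred X).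

Definition low_degree d h := exists2 p, (mpoly_degree p <= d)%N & represents p h.

Lemma low_degreeW d d' h : (d <= d')%N -> low_degree d h -> low_degree d' h.
Proof. by move=> le_d [p le_p rp]; exists p => //; apply: leq_trans le_d. Qed.

Lemma low_degree_cst d b : low_degree d (fun=> b).
Proof.
exists (mpolyC n (b%:R : 'F_2)); first by rewrite /mpoly_degree msizeC; case: (_ != _).
by move=> x; rewrite mevalC.
Qed.

Lemma low_degree_var (i : 'I_n) : low_degree 1 (fun x => tnth x i).
Proof.
exists (mpolyX _ (mnm1 i)); first by rewrite /mpoly_degree msizeX mdeg1.
by move=> x; rewrite mevalXU.
Qed.

Lemma low_degree_add d h1 h2 : low_degree d h1 -> low_degree d h2 ->
  low_degree d (fun x => h1 x (+) h2 x).
Proof.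
move=> [p1 le1 r1] [p2 le2 r2]; exists (p1 + p2).
  move: le1 le2; rewrite /mpoly_degree => le1 le2.
  have := msizeD_le p1 p2; rewrite /maxn; case: ifP; lia.
move=> x; rewrite mevalD r1 r2; case: (h1 x); case: (h2 x) => //=;
  by rewrite ?addr0 ?add0r //; apply/val_inj.
Qed.

Lemma low_degree_mul d1 d2 h1 h2 : low_degree d1 h1 -> low_degree d2 h2 ->
  low_degree (d1 + d2) (fun x => h1 x && h2 x).
Proof.
move=> [p1 le1 r1] [p2 le2 r2]; exists (p1 * p2).
  rewrite /mpoly_degree; move: le1 le2; rewrite /mpoly_degree => le1 le2.
  have [->|p1_neq0] := eqVneq p1 0; first by rewrite mul0r msize0.
  have [->|p2_neq0] := eqVneq p2 0; first by rewrite mulr0 msize0.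
  have arith a b : (a.-1 <= d1 -> b.-1 <= d2 -> (a + b).-1.-1 <= d1 + d2)%N by lia.
  by rewrite msizeM //; apply: arith.
by move=> x; rewrite mevalM r1 r2; case: (h1 x); case: (h2 x);
  rewrite ?mulr0 ?mul0r ?mulr1.
Qed.

Definition low_degree_on S d h :=
  exists2 h', low_degree d h' & forall x, S x -> h x = h' x.

Lemma low_degree_onW S d d' h : (d <= d')%N ->
  low_degree_on S d h -> low_degree_on S d' h.
Proof. by move=> le_d [h' lh' e]; exists h' => //; apply: low_degreeW lh'. Qed.

(** Algebraic normal form over [F_2]: an operation has degree at most one in each argument, so
    degrees at most add up at a gate. *)
Lemma boolop_anf (op : bool -> bool -> bool) : exists c0 c1 c2 c3, forall a b,
  op a b = (c0 (+) (a && c1)) (+) ((b && c2) (+) (a && b && c3)).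
Proof.
set c00 := op false false; set c10 := op true false.
set c01 := op false true; set c11 := op true true.
exists c00, (c10 (+) c00), (c01 (+) c00), (c11 (+) c10 (+) (c01 (+) c00)).
by move=> [] [] /=; rewrite -/c00 -/c10 -/c01 -/c11;
  case: c00; case: c10; case: c01; case: c11.
Qed.

Lemma low_degree_on_op S d1 d2 (op : bool -> bool -> bool) h h1 h2 :
    low_degree_on S d1 h1 -> low_degree_on S d2 h2 ->
    (forall x, S x -> h x = op (h1 x) (h2 x)) ->
  low_degree_on S (d1 + d2) h.
Proof.
move=> [g1 l1 e1] [g2 l2 e2] eh.
have [c0 [c1 [c2 [c3 anf]]]] := boolop_anf op.
exists (fun x => (c0 (+) (g1 x && c1)) (+) ((g2 x && c2) (+) (g1 x && g2 x && c3))).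
  have lc c : low_degree 0 (fun=> c) by exact: low_degree_cst.
  apply: low_degree_add; apply: low_degree_add; first exact: low_degree_cst.
  - by rewrite -[d1]addn0; apply: (low_degreeW _ (low_degree_mul l1 (lc c1))); lia.
  - by apply: (low_degreeW _ (low_degree_mul l2 (lc c2))); lia.
  - rewrite -[(d1 + d2)%N]addn0; apply: low_degree_mul (lc c3).
    exact: low_degree_mul.
by move=> x Sx; rewrite eh // anf e1 // e2.
Qed.

Lemma low_degree_on_cst S d h b : (forall x, S x -> h x = b) ->
  low_degree_on S d h.
Proof. by move=> e; exists (fun=> b) => //; apply: low_degree_cst. Qed.

(** The nodes of the guessing tree. [S'] is fixed only up to pointwise equality, so that a guessed
    function can be replaced by a polynomial that agrees with it on [S] alone. *)
Inductive polyset d : pred X -> Prop :=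
| polysetT : polyset d xpredT
| polysetI S S' h b of polyset d S & low_degree d h
    & (forall x, S' x = S x && (h x == b)) : polyset d S'.

Definition guess S h b : pred X := fun x => S x && (h x == b).

Lemma polyset_guess d S h b :
  polyset d S -> low_degree_on S d h -> polyset d (guess S h b).
Proof.
move=> pS [h' lh' e]; apply: (polysetI (b := b) pS lh') => x.
by rewrite /guess; case Sx: (S x) => //=; rewrite e.
Qed.

Lemma card_guess S h : #|S| = (#|guess S h true| + #|guess S h false|)%N.
Proof.
rewrite -(cardID (fun x => h x) S); congr (_ + _)%N; apply: eq_card => x;
  rewrite !inE /guess /in_mem /=; case: (S x) => //=; by case: (h x).
Qed.

Variables (R : realType) (f : boolfun n).

Definition correlation_bound d (M : R) := forall h, low_degree d h ->
  `|\sum_x (-1) ^+ (f x (+) h x)| <= M.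

(** The indicator of [g x = b] is half of [1] plus the sign of [g x + b], so one more equation
    averages two sums over [S], with [h] and [h + g] as test functions. Nothing is lost, whatever
    the number of equations. *)
Lemma polyset_sum d M S h : correlation_bound d M -> polyset d S ->
  low_degree d h -> `|\sum_(x | S x) (-1) ^+ (f x (+) h x)| <= M.
Proof.
move=> cM pS; elim: pS h => [h|{}S S' g b _ IH lg eS h lh]; first exact: cM.
have -> : \sum_(x | S' x) (-1) ^+ (f x (+) h x) =
   2^-1 * (\sum_(x | S x) (-1) ^+ (f x (+) h x)
    + (-1) ^+ b * \sum_(x | S x) (-1) ^+ (f x (+) (h x (+) g x))) :> R.
  rewrite (eq_bigl _ _ eS) big_mkcondr mulr_sumr -big_split /= mulr_sumr.
  apply: eq_bigr => x _; rewrite addbA !signr_addb.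
  by case: (g x); case: (b) => //=; case: (f x); case: (h x) => /=; field.
rewrite normrM ger0_norm ?invr_ge0 // mulrC ler_pdivrMr // mulr_natr mulr2n.
apply: le_trans (ler_normD _ _) _; rewrite normrM normr_sign mul1r.
by rewrite lerD ?IH //; apply: low_degree_add.
Qed.

Lemma polyset_leaf d M S : correlation_bound d M -> polyset d S ->
  low_degree_on S d f -> #|S|%:R <= M.
Proof.
move=> cM pS [h lh e]; have := polyset_sum cM pS lh.
rewrite (eq_bigr (fun=> 1)); last by move=> x Sx; rewrite e // addbb.
by rewrite sumr_const ger0_norm.
Qed.

(** The sum of signs counts agreements minus disagreements, which is [2 ^+ n] times the difference
    of the probabilities. *)
Lemma Cor_degP d (r : R) : d%:R <= r ->
  correlation_bound d (2 ^+ n * Cor_deg f r).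
Proof.
move=> le_dr h [p le_p rp].
have -> : \sum_x (-1) ^+ (f x (+) h x) =
    2 ^+ n * (Pr R (fun x => f x == h x) - Pr R (fun x => f x != h x)).
  rewrite /Pr card_tuple card_bool natrX -mulrBl mulrCA divff ?expf_neq0 // mulr1.
  rewrite (bigID (fun x => f x == h x)) /=.
  rewrite (eq_bigr (fun=> 1)); last by move=> x /eqP ->; rewrite addbb.
  rewrite [in X in _ + X](eq_bigr (fun=> -1)); last first.
    by move=> x; case: (f x); case: (h x).
  rewrite !sumr_const mulNrn; congr (_%:R - _%:R); apply: eq_card => x;
    by rewrite !inE.
rewrite normrM ger0_norm ?exprn_ge0 // ler_pM2l ?exprn_gt0 //.
have Ph : `[< exists p, (mpoly_degree p)%:R <= r /\ represents p (finfun h) >].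
  apply/asboolP; exists p; split; first by apply: le_trans le_dr; rewrite ler_nat.
  by move=> x; rewrite ffunE.
have -> : `|Pr R (fun x => f x == h x) - Pr R (fun x => f x != h x)| =
   Cor R f (finfun h).
  rewrite /Cor; congr (`|_ - _|); rewrite /Pr; congr (_%:R / _);
  by apply: eq_card => x; rewrite !inE ffunE.
by rewrite /Cor_deg (bigD1 (finfun h)) //= le_max lexx.
Qed.

End LowDegree.

(** * Gate elimination *)

Section Budget.
Variable R : realType.
Implicit Types t : R.

(** The number of leaves allowed for [t] gates. The [+ 4] keeps it at least 1 when five gates are
    charged although only one is left. *)
Definition budget t : R := 2 `^ ((t + 4) / (39 / 10)).

Lemma budget_gt0 t : 0 < budget t.
Proof. by rewrite powR_gt0. Qed.

Lemma ler_budget t t' : t <= t' -> budget t <= budget t'.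
Proof.
by move=> le_t; rewrite ler_powR ?ler1n // ler_pM2r ?lerD2r // invr_gt0; lra.
Qed.

Lemma budget_ge1 t : - 4 <= t -> 1 <= budget t.
Proof.
move=> le_t; rewrite -(powRr0 2) ler_powR ?ler1n //.
by rewrite divr_ge0 //; lra.
Qed.

Lemma budgetB t k : budget (t - k) = budget t * 2 `^ (- (k / (39 / 10))).
Proof.
by rewrite /budget -powRD ?pnatr_eq0 ?implybT //; congr (_ `^ _); field.
Qed.

Lemma budget4 t : budget (t - 4) + budget (t - 4) <= budget t.
Proof.
rewrite budgetB -mulrDr ler_piMr ?(ltW (budget_gt0 _)) //.
have: (2 : R) `^ (- (4 / (39 / 10))) <= 2 `^ (- 1).
  by rewrite ler_powR ?ler1n //; lra.
by rewrite powR_inv1 //; lra.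
Qed.

(* This is where 3.9 comes from: [u = 2 ^ (- 1 / 3.9)] is just below the root of
   [u ^ 3 + u ^ 5 = 1]. *)
Lemma budget35 t : budget (t - 3) + budget (t - 5) <= budget t.
Proof.
rewrite !budgetB -mulrDr ler_piMr ?(ltW (budget_gt0 _)) //.
set u : R := 2 `^ (- (10 / 39)).
have u_ge0 : 0 <= u by rewrite powR_ge0.
have uX k : u ^+ k = 2 `^ (- (10 / 39) * k%:R) by rewrite -powR_mulrn // powRrM.
have -> : 2 `^ (- (3 / (39 / 10))) = u ^+ 3.
  by rewrite uX; congr (_ `^ _); field.
have -> : 2 `^ (- (5 / (39 / 10))) = u ^+ 5.
  by rewrite uX; congr (_ `^ _); field.
have u39 : u ^+ 39 = (2 ^+ 10)^-1.
  rewrite uX (_ : - (10 / 39) * 39%:R = - 10%:R) ?powR_intmul //; last by field.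
  by rewrite powRN powR_mulrn.
(* A rational upper bound for [u], checked on 39th powers by repeated squaring with rounding down,
   for which still [a ^ 3 + a ^ 5 <= 1]. *)
pose a : R := 67 / 80.
have le_ua : u <= a.
  rewrite -(@ler_pXn2r _ 39) ?nnegrE //; last by rewrite /a; lra.
  rewrite u39.
  have a2 : 54 / 77 <= a ^+ 2 by rewrite /a; lra.
  have a4 : 30 / 61 <= a ^+ 4.
    by rewrite (exprM a 2 2); apply: le_trans (lerXn2r 2 _ _ a2); rewrite ?nnegrE; lra.
  have a8 : 22 / 91 <= a ^+ 8.
    by rewrite (exprM a 4 2); apply: le_trans (lerXn2r 2 _ _ a4); rewrite ?nnegrE; lra.
  have a16 : 9 / 154 <= a ^+ 16.
    by rewrite (exprM a 8 2); apply: le_trans (lerXn2r 2 _ _ a8); rewrite ?nnegrE; lra.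
  have a32 : 1 / 293 <= a ^+ 32.
    by rewrite (exprM a 16 2); apply: le_trans (lerXn2r 2 _ _ a16); rewrite ?nnegrE; lra.
  rewrite (_ : a ^+ 39 = a ^+ 32 * (a ^+ 4 * (a ^+ 2 * a))); last by rewrite -exprSr -!exprD.
  apply: (@le_trans _ _ (1 / 293 * (30 / 61 * (54 / 77 * (67 / 80))))); first by lra.
  have b2 : 54 / 77 * (67 / 80) <= a ^+ 2 * a by apply: ler_pM => //; lra.
  have b4 : 30 / 61 * (54 / 77 * (67 / 80)) <= a ^+ 4 * (a ^+ 2 * a).
    by apply: ler_pM => //; lra.
  by apply: ler_pM => //; lra.
have a_ge0 : 0 <= a by rewrite /a; lra.
apply: (@le_trans _ _ (a ^+ 3 + a ^+ 5)); last by rewrite /a; lra.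
by rewrite lerD ?lerXn2r ?nnegrE.
Qed.

End Budget.

(** * Removing gates from a wiring *)

Section Elimination.
Variables (n N : nat) (v : 'I_N -> n.-tuple bool -> bool) (f : boolfun n).
Implicit Types (S : pred (n.-tuple bool)) (A D E : {set 'I_N}) (i j u o : 'I_N).

Definition avail A j := (j < n)%N || (j \in A).

(** The functions [v] never change during the elimination. Only the set [A] of remaining gates,
    their operations and their wires do, and the gate equations are required on [S] alone. *)
Definition wired S A (op : 'I_N -> bool -> bool -> bool) (l r : 'I_N -> 'I_N) :=
  forall i, i \in A ->
    [/\ (n <= i)%N, (l i < i)%N, (r i < i)%N, avail A (l i) & avail A (r i)] /\
    forall x, S x -> v i x = op i (v (l i) x) (v (r i) x).

Definition reads S A := exists o (phi : bool -> bool),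
  avail A o /\ forall x, S x -> f x = phi (v o x).

Definition redundant S A D i := (exists b, forall x, S x -> v i x = b) \/
  exists u (psi : bool -> bool),
    [/\ (u < i)%N, avail A u, u \notin D & forall x, S x -> v i x = psi (v u x)].

(** [D] holds gates that no remaining gate reads, [E] gates that can be bypassed. A wire outside [D]
    is traced back through redundant gates to a remaining wire, and the unary functions met on the
    way are absorbed into the operation of the reader. *)
Lemma eliminate S S' A D E op l r o phi : (0 < n)%N -> wired S A op l r ->
    {subset S' <= S} ->
    avail A o -> (forall x, S' x -> f x = phi (v o x)) ->
    D \subset A -> E \subset A ->
    (forall i, i \in E -> redundant S' A D i) ->
    (forall i, i \in A -> i \notin D -> i \notin E ->
       l i \notin D /\ r i \notin D) ->
    o \notin D ->
  (exists op' l' r', wired S' (A :\: (D :|: E)) op' l' r') /\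
  reads S' (A :\: (D :|: E)).
Proof.
move=> n_gt0 wA sS' ao fo sDA sEA hE hD oD.
have rep i : avail A i -> i \notin D -> exists u (psi : bool -> bool),
    [/\ (u <= i)%N, avail (A :\: (D :|: E)) u & forall x, S' x -> v i x = psi (v u x)].
  have [k lek] := ubnP i; elim: k i lek => // k IH i lek ai iD.
  have [iE|iNE] := boolP (i \in E); last first.
    exists i, id; split=> //; rewrite /avail finset.in_setD finset.in_setU (negPf iD) (negPf iNE).
    exact: ai.
  case: (hE i iE) => [[b eb]|[u [psi [lt_ui au uD eu]]]].
    (* A constant is written as a constant function of input 0, which exists because [n] is
       positive. *)
    have lt0N : (0 < N)%N by apply: leq_ltn_trans (ltn_ord i).
    by exists (Ordinal lt0N), (fun=> b); split=> //; rewrite /avail /= n_gt0.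
  have [w [chi [le_wu aw ew]]] := IH u (leq_trans lt_ui lek) au uD.
  exists w, (psi \o chi); split=> //; first by apply: leq_trans le_wu (ltnW lt_ui).
  by move=> x Sx; rewrite eu // ew.
split; last first.
  have [u [psi [_ au eu]]] := rep o ao oD.
  by exists u, (phi \o psi); split=> // x Sx; rewrite fo // eu.
suff /choice[g gP] : forall i, exists t : (bool -> bool -> bool) * 'I_N * 'I_N,
    i \in A :\: (D :|: E) ->
    [/\ (n <= i)%N, (t.1.2 < i)%N, (t.2 < i)%N, avail (A :\: (D :|: E)) t.1.2
       & avail (A :\: (D :|: E)) t.2] /\
    forall x, S' x -> v i x = t.1.1 (v t.1.2 x) (v t.2 x).
  by exists (fun i => (g i).1.1), (fun i => (g i).1.2), (fun i => (g i).2).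
move=> i; have [iA|iA] := boolP (i \in A :\: (D :|: E)); last by exists (andb, i, i).
move: (iA); rewrite finset.in_setD finset.in_setU negb_or -andbA => /and3P[iD iNE iA'].
have [[le_ni lt_li lt_ri al ar] ei] := wA i iA'.
have [lD rD] := hD i iA' iD iNE.
have [ul [pl [le_ul aul eul]]] := rep _ al lD.
have [ur [pr [le_ur aur eur]]] := rep _ ar rD.
exists ((fun a b => op i (pl a) (pr b)), ul, ur) => _; split=> /=.
  by split=> //; [apply: leq_ltn_trans lt_li | apply: leq_ltn_trans lt_ri].
by move=> x Sx; rewrite ei ?eul ?eur //; apply: sS'.
Qed.

End Elimination.

Lemma boolop_cases (op : bool -> bool -> bool) :
  [\/ exists psi : bool -> bool, forall a b, op a b = psi a,
      exists psi : bool -> bool, forall a b, op a b = psi b,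
      exists e, forall a b, op a b = a (+) b (+) e |
      exists al be ga, forall a b, op a b = ((a (+) al) && (b (+) be)) (+) ga].
Proof.
case e00: (op false false); case e01: (op false true);
  case e10: (op true false); case e11: (op true true);
first [ by apply: Or41; exists (op^~ false); do 2![case]; rewrite ?e00 ?e01 ?e10 ?e11
      | by apply: Or42; exists (op false); do 2![case]; rewrite ?e00 ?e01 ?e10 ?e11
      | by apply: Or43; exists false; do 2![case]; rewrite ?e00 ?e01 ?e10 ?e11
      | by apply: Or43; exists true; do 2![case]; rewrite ?e00 ?e01 ?e10 ?e11
      | by apply: Or44; exists true, true, true; do 2![case]; rewrite ?e00 ?e01 ?e10 ?e11
      | by apply: Or44; exists true, true, false; do 2![case]; rewrite ?e00 ?e01 ?e10 ?e11
      | by apply: Or44; exists true, false, true; do 2![case]; rewrite ?e00 ?e01 ?e10 ?e11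
      | by apply: Or44; exists true, false, false; do 2![case]; rewrite ?e00 ?e01 ?e10 ?e11
      | by apply: Or44; exists false, true, true; do 2![case]; rewrite ?e00 ?e01 ?e10 ?e11
      | by apply: Or44; exists false, true, false; do 2![case]; rewrite ?e00 ?e01 ?e10 ?e11
      | by apply: Or44; exists false, false, true; do 2![case]; rewrite ?e00 ?e01 ?e10 ?e11
      | by apply: Or44; exists false, false, false; do 2![case]; rewrite ?e00 ?e01 ?e10 ?e11 ].
Qed.

Lemma ltn_ord_neq N (i j : 'I_N) : (i < j)%N -> i != j.
Proof. by rewrite -(inj_eq val_inj) neq_ltn => ->. Qed.

Section GateElimination.
Variables (R : realType) (n N : nat) (v : 'I_N -> n.-tuple bool -> bool).
Variables (f : boolfun n) (M : R).
Hypotheses (n_gt0 : (0 < n)%N) (fM : correlation_bound f 16 M).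
Hypothesis v_input : forall i : 'I_N, (i < n)%N -> low_degree 1 (v i).

Lemma correlation_bound_ge0 : 0 <= M.
Proof. exact: le_trans (normr_ge0 _) (fM (low_degree_cst n 16 false)). Qed.

(** * Branching rules at a minimal counterexample *)

Section Step.
Variables (S : pred (n.-tuple bool)) (A : {set 'I_N}).
Variables (op : 'I_N -> bool -> bool -> bool) (l r : 'I_N -> 'I_N).
Variables (o : 'I_N) (phi : bool -> bool).
Hypotheses (pS : polyset 16 S) (wA : wired v S A op l r).
Hypotheses (ao : avail n A o) (fo : forall x, S x -> f x = phi (v o x)).
Hypothesis IH : forall (S' : pred (n.-tuple bool)) (A' : {set 'I_N}) op' l' r',
  (#|A'| < #|A|)%N -> polyset 16 S' -> wired v S' A' op' l' r' ->
  reads v f S' A' -> #|S'|%:R <= budget #|A'|%:R * M.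
Hypothesis big : ~ #|S|%:R <= budget #|A|%:R * M.

Definition uses (j i : 'I_N) := (l j == i) || (r j == i).

Lemma uses_lt j i : j \in A -> uses j i -> (i < j)%N.
Proof. by move=> /wA[[_ ? ? _ _] _] /orP[] /eqP <-. Qed.

(** The induction hypothesis as the rules use it. [S'] is [S] itself or one branch of a guess, and
    [uniq] makes the sizes of the lists the number of gates removed. *)
Lemma kill S' (D E : seq 'I_N) : polyset 16 S' -> {subset S' <= S} ->
    uniq (D ++ E) -> {subset D ++ E <= A} -> (0 < size (D ++ E))%N ->
    (forall i, i \in E -> redundant v S' A [set x in D]%SET i) ->
    (forall i j, i \in A -> i \notin D ++ E -> j \in D -> ~~ uses i j) ->
    o \notin D ->
  #|S'|%:R <= budget (#|A|%:R - (size (D ++ E))%:R) * M.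
Proof.
move=> pS' sS' uDE sDE s_gt0 hE hD oD.
pose K := [set x in D]%SET :|: [set x in E]%SET.
have sK : K \subset A.
  by apply/fintype.subsetP=> x; rewrite !inE -mem_cat; apply: sDE.
have cK : #|K| = size (D ++ E).
  rewrite -(card_uniqP uDE); apply: eq_card => x; rewrite !inE mem_cat.
  by [].
have [|||||[op' [l' [r' w']]] rd] := eliminate (D := [set x in D]%SET)
  (E := [set x in E]%SET) (f := f) n_gt0 wA sS' ao (fun x Sx => fo (sS' x Sx)).
- by apply/fintype.subsetP=> x; rewrite inE => xD; apply: sDE; rewrite mem_cat xD.
- by apply/fintype.subsetP=> x; rewrite inE => xE; apply: sDE; rewrite mem_cat xE orbT.
- by move=> i; rewrite inE => /hE.
- move=> i iA; rewrite !inE => iD iE.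
  have iDE : i \notin D ++ E by rewrite mem_cat negb_or iD.
  split; apply/negP=> jD; have := hD _ _ iA iDE jD; rewrite /uses eqxx ?orbT //.
- by rewrite inE.
have cA' : #|A :\: K| = (#|A| - size (D ++ E))%N.
  by rewrite cardsD (finset.setIidPr sK) cK.
have le_s : (size (D ++ E) <= #|A|)%N by rewrite -cK subset_leq_card.
rewrite -natrB // -cA'; apply: IH w' rd => //.
by rewrite cA'; move: s_gt0 le_s; lia.
Qed.

Lemma kill_guess i b (D E : seq 'I_N) : low_degree_on S 16 (v i) ->
    uniq (D ++ E) -> {subset D ++ E <= A} -> (0 < size (D ++ E))%N ->
    (forall j, j \in E -> redundant v (guess S (v i) b) A [set x in D]%SET j) ->
    (forall i j, i \in A -> i \notin D ++ E -> j \in D -> ~~ uses i j) ->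
    o \notin D ->
  #|guess S (v i) b|%:R <= budget (#|A|%:R - (size (D ++ E))%:R) * M.
Proof.
by move=> li; apply: kill; [exact: polyset_guess | move=> x /andP[]].
Qed.

(** Bypassing such a gate costs no guess, and the bound for the smaller wiring implies the one that
    fails. *)
Lemma not_redundant i : i \in A -> ~ redundant v S A [set x in [::]]%SET i.
Proof.
move=> iA ri; apply: big.
apply: le_trans (_ : _ <= budget (#|A|%:R - (size ([::] ++ [:: i]))%:R) * M) _.
  apply: kill => //.
  - by move=> j; rewrite inE => /eqP ->.
  - by move=> j; rewrite inE => /eqP ->.
by rewrite ler_wpM2r ?correlation_bound_ge0 // ler_budget // gerBl.
Qed.

Lemma low_output_contra : ~ low_degree_on S 16 (v o).
Proof.
move=> lo; apply: big; apply: le_trans (_ : _ <= M) _.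
  apply: (polyset_leaf fM pS).
  have lc : low_degree_on S 0 (fun=> false) by exact: low_degree_on_cst.
  exact: (low_degree_on_op (op := fun a _ => phi a) lo lc fo).
by rewrite ler_peMl ?correlation_bound_ge0 // budget_ge1 //; apply: le_trans (ler0n _ _); lra.
Qed.

Lemma has_user i : i \in A -> i != o -> exists2 j, j \in A & uses j i.
Proof.
move=> iA io; apply: contrapT => nu; apply: big.
apply: le_trans (_ : _ <= budget (#|A|%:R - (size ([:: i] ++ [::]))%:R) * M) _.
  apply: kill => //.
  - by move=> j; rewrite inE => /eqP ->.
  - move=> k j kA _; rewrite inE => /eqP ->; apply/negP=> uki.
    by apply: nu; exists k.
  - by rewrite inE eq_sym.
by rewrite ler_wpM2r ?correlation_bound_ge0 // ler_budget // gerBl.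
Qed.

Lemma low_neq_output i : low_degree_on S 16 (v i) -> i != o.
Proof. by move=> li; apply/eqP=> io; apply: low_output_contra; rewrite -io. Qed.

Lemma branch44 i : (forall b, #|guess S (v i) b|%:R <= budget (#|A|%:R - 4) * M) ->
  False.
Proof.
move=> h; apply: big; rewrite (card_guess S (v i)) natrD.
apply: le_trans (lerD (h true) (h false)) _.
by rewrite -mulrDl ler_wpM2r ?correlation_bound_ge0 // budget4.
Qed.

Lemma branch35 i c : #|guess S (v i) (~~ c)|%:R <= budget (#|A|%:R - 3) * M ->
  #|guess S (v i) c|%:R <= budget (#|A|%:R - 5) * M -> False.
Proof.
move=> h3 h5; apply: big; rewrite (card_guess S (v i)) natrD.
apply: le_trans (_ : _ <= (budget (#|A|%:R - 3) + budget (#|A|%:R - 5)) * M) _.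
  rewrite mulrDl; case: c h3 h5 => /= h3 h5; last exact: lerD.
  by rewrite addrC lerD.
by rewrite ler_wpM2r ?correlation_bound_ge0 // budget35.
Qed.

Lemma guess_cst i b : exists c, forall x, guess S (v i) b x -> v i x = c.
Proof. by exists b => x /andP[_ /eqP]. Qed.

(** With one input constant, a gate is a unary function of its other input, which must not be
    dropped with [D]. *)
Lemma user_redundant S' (D : {set 'I_N}) i j c : {subset S' <= S} ->
  (forall x, S' x -> v i x = c) -> j \in A -> uses j i ->
  (forall k, k \in D -> ~~ uses j k) -> redundant v S' A D j.
Proof.
move=> sS' ci jA /orP[/eqP li|/eqP ri] nD; right;
  have [[_ ltl ltr al ar] e] := wA jA.
  exists (r j), (op j c); split=> // [|x Sx].
    by apply/negP=> /nD; rewrite /uses eqxx orbT.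
  by rewrite e ?li ?ci //; apply: sS'.
exists (l j), (op j ^~ c); split=> // [|x Sx].
  by apply/negP=> /nD; rewrite /uses eqxx.
by rewrite e ?ri ?ci //; apply: sS'.
Qed.

Lemma inputs_neq i : i \in A -> l i != r i.
Proof.
move=> iA; apply/eqP=> lr; apply: (not_redundant iA); right.
have [[_ ltl ltr al ar] e] := wA iA.
by exists (l i), (fun a => op i a a); split; rewrite ?inE // => x Sx; rewrite e // -lr.
Qed.

Lemma and_or_xor_gate i : i \in A ->
  (exists e, forall a b, op i a b = a (+) b (+) e) \/
  (exists al be ga, forall a b, op i a b = ((a (+) al) && (b (+) be)) (+) ga).
Proof.
move=> iA; have [[_ ltl ltr al ar] e] := wA iA.
case: (boolop_cases (op i)) => [[psi ep]|[psi ep]|h|h]; [| |by left|by right];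
  case: (not_redundant iA); right.
  by exists (l i), psi; split; rewrite ?inE // => x Sx; rewrite e // ep.
by exists (r i), psi; split; rewrite ?inE // => x Sx; rewrite e // ep.
Qed.

Definition sole_user i j := j \in A /\ forall k, k \in A -> uses k j -> k = i.

(** Users have larger numbers, so climbing from user to user can only stop at [o]. *)
Lemma le_output i : i \in A -> (i <= o)%N.
Proof.
have [k] := ubnP (N - i); elim: k i => // k IHk i lek iA.
have [->//|io] := eqVneq i o; have [j jA /(uses_lt jA) lt_ij] := has_user iA io.
apply: leq_trans (ltnW lt_ij) (IHk j _ jA).
by have := ltn_ord j; lia.
Qed.

(* Guessing [i] kills [i] and one of its users, and makes [a] and [b] useless. *)
Lemma rule_tree i (a b : 'I_N) : i \in A -> low_degree_on S 16 (v i) ->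
  a != b -> (a < i)%N -> (b < i)%N -> sole_user i a ->
  b \in A -> (forall k, k \in A -> uses k b -> k = i \/ k = a) -> False.
Proof.
move=> iA li ab lt_ai lt_bi [aA ua] bA ub.
have [j jA uji] := has_user iA (low_neq_output li).
have lt_ij := uses_lt jA uji; have le_io := le_output iA.
have [lt_aj lt_bj] := (ltn_trans lt_ai lt_ij, ltn_trans lt_bi lt_ij).
have [lt_ao lt_bo] := (leq_trans lt_ai le_io, leq_trans lt_bi le_io).
apply: (@branch44 i) => c; have [d di] := guess_cst i c.
apply: (@kill_guess i c [:: a; b] [:: i; j]) => //.
- by rewrite /= !inE !negb_or ab !ltn_ord_neq.
- by move=> x; rewrite !inE => /or4P[] /eqP ->.
- move=> k; rewrite !inE => /orP[] /eqP ->; first by left; exists d.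
  apply: (user_redundant _ di jA uji) => [x /andP[]//|k']; rewrite !inE.
  case/orP=> /eqP ->; apply/negP.
    by move/(ua _ jA) => ji; move: lt_ij; rewrite ji ltnn.
  case/(ub _ jA) => ji; move: lt_ij; rewrite ji ?ltnn //.
  by move/(ltn_trans lt_ai); rewrite ltnn.
- move=> k k' kA kDE k'D; rewrite !inE !negb_or in kDE.
  case/and4P: kDE => ka kb ki kj.
  move: k'D; rewrite !inE; case/orP=> /eqP ->; apply/negP; first by move/(ua _ kA)=> E; rewrite E eqxx in ki.
  by case/(ub _ kA)=> E; [rewrite E eqxx in ki | rewrite E eqxx in ka].
- by rewrite !inE (eq_sym o a) (eq_sym o b) negb_or !ltn_ord_neq.
Qed.

(* Once the sum [i] is guessed, its later summand is the other one up to a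
   constant. *)
Lemma rule_xor i e j1 j2 : i \in A -> low_degree_on S 16 (v i) ->
    (forall a b, op i a b = a (+) b (+) e) -> (n <= l i)%N || (n <= r i)%N ->
  j1 \in A -> j2 \in A -> uses j1 i -> uses j2 i -> j1 != j2 -> False.
Proof.
move=> iA li opi top j1A j2A u1 u2 j12.
have [lt1 lt2] := (uses_lt j1A u1, uses_lt j2A u2).
have [[_ ltl ltr al ar] ei] := wA iA; have lr := inputs_neq iA.
(* [p] is the later summand. One summand is a gate and inputs are numbered first, so [p] is a gate
   and can be bypassed towards the earlier wire [q]. *)
have [p [q [lt_qp lt_pi aq epq]]] : exists p q : 'I_N, [/\ (q < p)%N, (p < i)%N, avail n A q
    & (n <= p)%N /\ p \in A /\ forall x, S x -> v p x = v q x (+) (v i x (+) e)].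
  move: lr; rewrite -(inj_eq val_inj) neq_ltn /= => /orP[lt|lt].
    exists (r i), (l i); have np : (n <= r i)%N by case/orP: top => // h; apply: leq_trans h (ltnW lt).
    split=> //; split=> //; split; first by move: ar; rewrite /avail ltnNge np.
    by move=> x Sx; rewrite ei // opi; case: (v (l i) x); case: (v (r i) x); case: (e).
  exists (l i), (r i); have np : (n <= l i)%N by case/orP: top => // h; apply: leq_trans h (ltnW lt).
  split=> //; split=> //; split; first by move: al; rewrite /avail ltnNge np.
  by move=> x Sx; rewrite ei // opi; case: (v (l i) x); case: (v (r i) x); case: (e).
have [np [pA ep]] := epq.
have [ltp1 ltp2] := (ltn_trans lt_pi lt1, ltn_trans lt_pi lt2).
apply: (@branch44 i) => c; have [d di] := guess_cst i c.
apply: (@kill_guess i c [::] [:: p; i; j1; j2]) => //.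
- by rewrite /= !inE !negb_or j12 !ltn_ord_neq.
- by move=> x; rewrite !inE => /or4P[] /eqP ->.
- have sub : {subset guess S (v i) c <= S} by move=> x /andP[].
  have nD j k : k \in [set x in [::] : seq 'I_N]%SET -> ~~ uses j k by rewrite inE.
  move=> k; rewrite !inE => /or4P[] /eqP ->.
  + right; exists q, (fun a => a (+) (d (+) e)); split; rewrite ?inE // => x Gx.
    by rewrite ep ?di //; apply: sub.
  + by left; exists d.
  + exact: user_redundant sub di j1A u1 (nD _).
  + exact: user_redundant sub di j2A u2 (nD _).
Qed.

(** A constant output ends the branch, so no fifth gate has to be found: [i] is a gate, hence
    [#|A| - 5 >= - 4] and the budget is still at least 1. *)
Lemma const_output_branch i c d : low_degree_on S 16 (v i) -> i \in A ->
  (forall x, guess S (v i) c x -> v o x = d) ->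
  #|guess S (v i) c|%:R <= budget (#|A|%:R - 5) * M.
Proof.
move=> li iA od; apply: le_trans (_ : _ <= M) _.
  apply: (polyset_leaf fM (polyset_guess c pS li)).
  apply: (low_degree_on_cst 16 (b := phi d)) => x Gx.
  by rewrite fo ?od //; move/andP: Gx => [].
rewrite ler_peMl ?correlation_bound_ge0 // budget_ge1 //.
have : (1 : R) <= #|A|%:R by rewrite ler1n; apply/card_gt0P; exists i.
by lra.
Qed.

(* One of the two guesses of the product [i] makes both factors constant. *)
Lemma rule_and i al be ga p j1 j2 : i \in A -> low_degree_on S 16 (v i) ->
    (forall a b, op i a b = ((a (+) al) && (b (+) be)) (+) ga) ->
    uses i p -> p \in A ->
  j1 \in A -> j2 \in A -> uses j1 i -> uses j2 i -> j1 != j2 -> False.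
Proof.
move=> iA li opi uip pA j1A j2A u1 u2 j12.
have [lt1 lt2 lt_pi] := And3 (uses_lt j1A u1) (uses_lt j2A u2) (uses_lt iA uip).
have [ltp1 ltp2] := (ltn_trans lt_pi lt1, ltn_trans lt_pi lt2).
have [_ ei] := wA iA.
have sub c : {subset guess S (v i) c <= S} by move=> x /andP[].
(* If only [i] reads [p], then [p] becomes unread, and both guesses remove [p], [i], [j1] and
   [j2]. *)
have [sole|] := pselect (forall k, k \in A -> uses k p -> k = i).
  apply: (@branch44 i) => c; have [d di] := guess_cst i c.
  apply: (@kill_guess i c [:: p] [:: i; j1; j2]) => //.
  - by rewrite /= !inE !negb_or j12 !ltn_ord_neq.
  - by move=> x; rewrite !inE => /or4P[] /eqP ->.
  - have nD j k : j \in A -> (i < j)%N -> k \in [set x in [:: p]]%SET -> ~~ uses j k.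
      move=> jA lt_ij; rewrite !inE => /eqP ->; apply/negP=> /(sole _ jA) ji.
      by move: lt_ij; rewrite ji ltnn.
    move=> k; rewrite !inE => /or3P[] /eqP ->; first by left; exists d.
      by apply: (user_redundant (sub c) di j1A u1) => k'; apply: nD.
    by apply: (user_redundant (sub c) di j2A u2) => k'; apply: nD.
  - move=> k k' kA kDE k'D; rewrite !inE !negb_or in kDE.
    case/and4P: kDE => _ ki _ _.
    by move: k'D; rewrite inE => /eqP ->; apply/negP=> /(sole _ kA) E; rewrite E eqxx in ki.
  - by rewrite !inE eq_sym ltn_ord_neq // (leq_trans lt_pi) ?le_output.
move/existsNP=> [y /not_implyP[yA /not_implyP[uyp /eqP yi]]].
have nD j k : k \in [set x in [::] : seq 'I_N]%SET -> ~~ uses j k by rewrite inE.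
have lt_py := uses_lt yA uyp.
(* The value [~~ ga] forces both factors to be true, so [p] is constant on that branch and five
   gates can go. The value [ga] removes [i], [j1] and [j2]. *)
apply: (@branch35 i (~~ ga)).
  rewrite negbK; have [d di] := guess_cst i ga.
  apply: (@kill_guess i ga [::] [:: i; j1; j2]) => //.
  - by rewrite /= !inE !negb_or j12 !ltn_ord_neq.
  - by move=> x; rewrite !inE => /or3P[] /eqP ->.
  move=> k; rewrite !inE => /or3P[] /eqP ->; first by left; exists d.
    exact: user_redundant (sub _) di j1A u1 (nD _).
  exact: user_redundant (sub _) di j2A u2 (nD _).
set G := guess S (v i) (~~ ga).
have [d di] : exists d, forall x, G x -> v i x = d by exact: guess_cst.
have [dp dip] : exists d, forall x, G x -> v p x = d.
  have h x : G x -> (v (l i) x = ~~ al) /\ (v (r i) x = ~~ be).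
    move=> /andP[Sx /eqP]; rewrite ei // opi.
    by case: (v (l i) x); case: (v (r i) x); case: (al); case: (be); case: (ga).
  case/orP: uip => /eqP <-; [exists (~~ al)|exists (~~ be)]; by move=> x /h[].
have both_const (k k1 k2 : 'I_N) d1 d2 : k \in A -> uses k k1 -> uses k k2 -> k1 != k2 ->
    (forall x, G x -> v k1 x = d1) -> (forall x, G x -> v k2 x = d2) ->
    exists d, forall x, G x -> v k x = d.
  move=> kA uk1 uk2 k12 e1 e2; have [_ ek] := wA kA.
  have h : (l k = k1 /\ r k = k2) \/ (l k = k2 /\ r k = k1).
    case/orP: uk1 => /eqP e; case/orP: uk2 => /eqP e'; [|by left|by right|];
    by move: k12; rewrite -e -e' eqxx.
  case: h => [[el er]|[el er]].
    by exists (op k d1 d2) => x Gx; rewrite ek ?el ?er ?e1 ?e2 //; apply: sub Gx.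
  by exists (op k d2 d1) => x Gx; rewrite ek ?el ?er ?e1 ?e2 //; apply: sub Gx.
have finish y1 y2 y3 : y1 \in A -> y2 \in A -> y3 \in A ->
    uniq [:: p; i; y1; y2; y3] -> redundant v G A [set x in [::]]%SET y1 ->
    redundant v G A [set x in [::]]%SET y2 -> redundant v G A [set x in [::]]%SET y3 ->
    #|G|%:R <= budget (#|A|%:R - 5) * M.
  move=> A1 A2 A3 un r1 r2 r3.
  apply: (@kill_guess i (~~ ga) [::] [:: p; i; y1; y2; y3]) => //.
  - by move=> x; rewrite !inE => /orP[|/or4P[]] /eqP ->.
  - move=> k; rewrite !inE => /orP[|/or4P[]] /eqP -> //; first by left; exists dp.
    by left; exists d.
have red j k c : j \in A -> uses j k -> (forall x, G x -> v k x = c) ->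
    redundant v G A [set x in [::]]%SET j.
  by move=> jA ujk ek; apply: user_redundant (sub _) ek jA ujk (nD _).
have pi := ltn_ord_neq lt_pi.
(* [k1] reads both [p] and [i], hence is constant and kills one gate more. *)
have shared k1 k2 : k1 \in A -> k2 \in A -> uses k1 i -> uses k2 i -> k1 != k2 ->
    uses k1 p -> #|G|%:R <= budget (#|A|%:R - 5) * M.
  move=> A1 A2 v1 v2 k12 up.
  have [ltk1 ltk2] := (uses_lt A1 v1, uses_lt A2 v2).
  have [ltp1' ltp2'] := (ltn_trans lt_pi ltk1, ltn_trans lt_pi ltk2).
  have [d1 e1] := both_const _ _ _ _ _ A1 up v1 pi dip di.
  have [ko|ko] := eqVneq k1 o; first by apply: const_output_branch li iA _; rewrite -ko; apply: e1.
  have [w wA' uw] := has_user A1 ko; have lt_w := uses_lt wA' uw.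
  have [wk2|wk2] := eqVneq w k2; last first.
    apply: (finish k1 k2 w) => //; [|by left; exists d1|exact: red v2 di|exact: red uw e1].
    have lt_iw := ltn_trans ltk1 lt_w; have lt_pw := ltn_trans lt_pi lt_iw.
    by rewrite /= !inE !negb_or [k2 == w]eq_sym wk2 k12 !ltn_ord_neq.
  (* The user of [k1] is [k2] itself, which reads the constants [k1] and [i]. The fifth gate is then
     a user of [k2], unless [k2] is the output. *)
  have k1i : k1 != i by rewrite eq_sym ltn_ord_neq.
  rewrite wk2 in uw.
  have [d2 e2] := both_const _ _ _ _ _ A2 uw v2 k1i e1 di.
  have [ko2|ko2] := eqVneq k2 o.
    by apply: const_output_branch li iA _; rewrite -ko2; apply: e2.
  have [w2 w2A uw2] := has_user A2 ko2; have lt_w2 := uses_lt w2A uw2.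
  rewrite wk2 in lt_w.
  apply: (finish k1 k2 w2) => //;
    [|by left; exists d1|by left; exists d2|exact: red uw2 e2].
  have lt_iw := ltn_trans ltk2 lt_w2; have lt_pw := ltn_trans lt_pi lt_iw.
  have lt_1w := ltn_trans lt_w lt_w2.
  by rewrite /= !inE !negb_or k12 !ltn_ord_neq.
have [yj1|yj1] := eqVneq y j1; first by apply: (shared j1 j2) => //; rewrite -yj1.
have [yj2|yj2] := eqVneq y j2.
  by apply: (shared j2 j1) => //; [rewrite eq_sym | rewrite -yj2].
apply: (finish y j1 j2) => //; [|exact: red uyp dip|exact: red u1 di|exact: red u2 di].
by rewrite /= !inE !negb_or yj1 yj2 j12 [i == y]eq_sym yi !ltn_ord_neq.
Qed.

Lemma no_branching_gate i j1 j2 : i \in A -> low_degree_on S 16 (v i) ->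
  j1 \in A -> j2 \in A -> uses j1 i -> uses j2 i -> j1 != j2 ->
  (l i < n)%N /\ (r i < n)%N.
Proof.
move=> iA li j1A j2A u1 u2 j12; have [[_ _ _ al ar] _] := wA iA.
apply: contrapT => /not_andP nt.
have top : (n <= l i)%N || (n <= r i)%N.
  by case: (ltnP (l i) n) => //= ln; case: (ltnP (r i) n) => //= rn; case: nt.
have [[e opi]|[a [b [c opi]]]] := and_or_xor_gate iA.
  exact: (rule_xor iA li opi top j1A j2A u1 u2 j12).
have [p up pA] : exists2 p, uses i p & p \in A.
  case/orP: top => np; [exists (l i)|exists (r i)]; rewrite /uses ?eqxx ?orbT //.
    by move: al; rewrite /avail ltnNge np.
  by move: ar; rewrite /avail ltnNge np.
exact: (rule_and iA li opi up pA j1A j2A u1 u2 j12).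
Qed.

Definition exclusive i := i \in A /\
  forall j1 j2, j1 \in A -> j2 \in A -> uses j1 i -> uses j2 i -> j1 = j2.

Lemma exclusive_sole i j : exclusive j -> i \in A -> uses i j -> sole_user i j.
Proof. by move=> [jA h] iA uij; split=> // k kA ukj; apply: h. Qed.

(** A gate with two users reads two inputs and has degree 2. Without exclusive predecessors the
    degree is at most [2 + 2]. An exclusive predecessor has degree at most 4 and its companion at
    most 2, which gives 6. *)
Lemma gate_degree i : i \in A ->
  [/\ low_degree_on S 6 (v i), ~ exclusive i -> low_degree_on S 2 (v i) &
      (forall j, uses i j -> ~ exclusive j) -> low_degree_on S 4 (v i)].
Proof.
have [k] := ubnP i; elim: k i => // k IHk i lek iA.
have [[_ ltl ltr al ar] ei] := wA iA.
have in6 j : uses i j -> low_degree_on S 6 (v j).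
  move=> uij; have lt_ji := uses_lt iA uij.
  have : avail n A j by case/orP: uij => /eqP <-.
  case/orP=> [jn|jA]; first by exists (v j) => //; apply: low_degreeW (v_input jn).
  by case: (IHk j (leq_trans lt_ji lek) jA).
have in2 j : uses i j -> ~ exclusive j -> low_degree_on S 2 (v j).
  move=> uij ne; have lt_ji := uses_lt iA uij.
  have : avail n A j by case/orP: uij => /eqP <-.
  case/orP=> [jn|jA]; first by exists (v j) => //; apply: low_degreeW (v_input jn).
  by case: (IHk j (leq_trans lt_ji lek) jA) => _ h _; apply: h.
have ul : uses i (l i) by rewrite /uses eqxx.
have ur : uses i (r i) by rewrite /uses eqxx orbT.
(* The crude bound [6 + 6] already allows [i] to be guessed, so the branching rules apply to it. *)
have li12 : low_degree_on S 16 (v i).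
  exact: low_degree_onW (low_degree_on_op (in6 _ ul) (in6 _ ur) ei).
have class1 : (forall j, uses i j -> ~ exclusive j) -> low_degree_on S 4 (v i).
  by move=> h; apply: low_degree_on_op (in2 _ ul (h _ ul)) (in2 _ ur (h _ ur)) ei.
(* an exclusive input has no exclusive companion, otherwise [rule_tree] applies *)
have class2 (a b : 'I_N) : uses i a -> uses i b -> a != b -> exclusive a ->
    low_degree_on S 4 (v a) /\ low_degree_on S 2 (v b).
  move=> ua ub ab exa; have [lta ltb] := (uses_lt iA ua, uses_lt iA ub).
  have sa := exclusive_sole exa iA ua; have aA := exa.1; split.
    have [_ _ ca] := IHk a (leq_trans lta lek) aA.
    apply: ca => c uac exc; have ltc := uses_lt aA uac.
    apply: (rule_tree iA li12 (a := a) (b := c)) => //.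
    - by rewrite eq_sym ltn_ord_neq.
    - exact: ltn_trans lta.
    - by case: exc.
    - by move=> k' kA uk; right; apply: exc.2.
  apply: in2 => // exb.
  apply: (rule_tree iA li12 ab lta ltb sa exb.1) => k' kA uk; left.
  exact: exb.2.
split=> //.
- have [exl|nexl] := pselect (exclusive (l i)).
    have [h4 h2] := class2 _ _ ul ur (inputs_neq iA) exl.
    exact: low_degree_on_op h4 h2 ei.
  have [exr|nexr] := pselect (exclusive (r i)).
    have rl : r i != l i by rewrite eq_sym inputs_neq.
    have [h4 h2] := class2 _ _ ur ul rl exr.
    exact: (low_degree_on_op h2 h4 ei).
  apply: low_degree_onW (class1 _) => // j /orP[] /eqP <- //.
- move=> nex; have : ~ forall j1 j2, j1 \in A -> j2 \in A -> uses j1 i -> uses j2 i -> j1 = j2.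
    by move=> h; apply: nex.
  case/existsNP=> j1 /existsNP[j2] /not_implyP[j1A] /not_implyP[j2A].
  case/not_implyP=> u1 /not_implyP[u2 /eqP j12].
  have [ln rn] := no_branching_gate iA li12 j1A j2A u1 u2 j12.
  have h1 (j : 'I_N) : (j < n)%N -> low_degree_on S 1 (v j) by move=> jn; exists (v j); [exact: v_input|].
  exact: low_degree_on_op (h1 _ ln) (h1 _ rn) ei.
Qed.

Lemma step_contra : False.
Proof.
apply: low_output_contra; case/orP: ao => [on|oA].
  by exists (v o) => //; apply: low_degreeW (v_input on).
by have [h _ _] := gate_degree oA; apply: low_degree_onW h.
Qed.

End Step.

Lemma elimination_bound S (A : {set 'I_N}) op l r : polyset 16 S ->
  wired v S A op l r -> reads v f S A -> #|S|%:R <= budget #|A|%:R * M.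
Proof.
have [k] := ubnP #|A|; elim: k S A op l r => // k IHk S A op l r lek pS wA [y [phi [ao fo]]].
apply: contrapT => big; apply: (step_contra pS wA ao fo _ big).
move=> S' A' op' l' r' ltA' pS' w' rd'; apply: IHk w' rd' => //.
by apply: leq_trans ltA' _; rewrite -ltnS.
Qed.

End GateElimination.

(** * Paths in noncrossing graphs *)

Section NoncrossingWalks.
Local Open Scope nat_scope.

Inductive walk (e : rel nat) (p : nat) : nat -> nat -> Prop :=
| walk0 : walk e p 0 p
| walkS m q q' of walk e p m q & e q q' : walk e p m.+1 q'.

Lemma walk0E e p q : walk e p 0 q -> p = q.
Proof. by move E: 0 => m w; case: w E. Qed.

Section Walks.
Variable e : rel nat.
Hypothesis e_lt : forall p q, e p q -> p < q.

Lemma walk_le p m q : walk e p m q -> p <= q.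
Proof. by elim=> // {}m {}q q' _ le_pq /e_lt; lia. Qed.

Lemma walk_refl p m q : walk e p m q -> q <= p -> m = 0.
Proof.
by case=> // {}m {}q q' /walk_le le_pq /e_lt lt_qq' le_q'p; lia.
Qed.

Lemma walk_sub (e' : rel nat) a c p m q : a <= p ->
  (forall p q, a <= p -> q <= c -> e p q -> e' p q) ->
  walk e p m q -> q <= c -> walk e' p m q.
Proof.
move=> le_ap sub; elim=> [|{}m {}q q' w IH eqq'] le_qc; first exact: walk0.
have lt_qq' := e_lt eqq'; have le_pq := walk_le w.
by apply: walkS (IH _) (sub _ _ _ _ eqq') => //; lia.
Qed.

(** Unless the walk starts at [b], its first edge that reaches [b] or beyond ends at [b] or jumps
    over it. In the latter case the edge goes from [a] to [c], and no other edge fits before or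
    after it. *)
Lemma walk_split a b c p m q : a <= p -> a < b < c ->
    (forall p q, e p q -> a <= p < b -> b < q <= c -> p = a /\ q = c) ->
  walk e p m q -> p <= b -> b <= q <= c ->
  [/\ m = 1, p = a, q = c & e a c] \/
  exists m1 m2, [/\ walk e p m1 b, walk e b m2 q & m = m1 + m2].
Proof.
move=> le_ap /andP[lt_ab lt_bc] jump.
elim=> [|{}m {}q q' w IH eqq'] le_pb /andP[le_bq' le_q'c].
  right; exists 0, 0; have -> : p = b by lia.
  by split=> //; exact: walk0.
have lt_qq' := e_lt eqq'; have le_pq := walk_le w.
have [le_bq|lt_qb] := leqP b q.
  have [||[_ _ qc _]|[m1 [m2 [w1 w2 ->]]]] := IH => //; try lia.
  right; exists m1, m2.+1; split=> //; [exact: walkS w2 eqq' | lia].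
have [bq'|neq_bq'] := eqVneq b q'.
  right; exists m.+1, 0; rewrite addn0; split=> //.
    by rewrite bq'; apply: walkS w eqq'.
  by rewrite -bq'; exact: walk0.
have [qa q'c] : q = a /\ q' = c by apply: jump eqq' _ _; lia.
left; have pa : p = a by lia.
have m0 : m = 0 by apply: walk_refl w _; lia.
by split=> //; [rewrite m0 | rewrite -qa -q'c].
Qed.

End Walks.

(** * The tree of splitting points and its turn counters *)

Section Noncrossing.
Variable e : rel nat.
Hypothesis e_lt : forall p q, e p q -> p < q.
Hypothesis e_nc : forall p q p' q', e p q -> e p' q' ->
  ~~ [&& p < p', p' < q & q < q'].

(** The largest end below [c] of an edge from [a]. The default [a.+1] serves when there is none, as
    nothing lies strictly between [a] and [a.+1]. *)
Definition apex a c := last a.+1 [seq b <- iota a.+1 (c - a.+1) | e a b].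

(** An edge from [a] past the apex ends at [c] by maximality. One that starts strictly between [a]
    and the apex and passes it would cross the edge from [a] to the apex. *)
Lemma apexP a c : a.+1 < c ->
  a < apex a c < c /\
  forall p q, e p q -> a <= p < apex a c -> apex a c < q <= c ->
    p = a /\ q = c.
Proof.
move=> lt_ac.
have H : (apex a c = a.+1 /\ forall b, a < b < c -> ~~ e a b) \/
  [/\ a < apex a c < c, e a (apex a c) &
     forall b, apex a c < b < c -> ~~ e a b].
  rewrite /apex; move: (ltnW lt_ac) => /subnKC <-; rewrite addKn.
  elim: (c - a.+1) => [|k IH]; first by left; split=> // b; lia.
  rewrite -[k.+1]addn1 iotaD filter_cat last_cat /=.
  case: ifP => [ek|/negbT nek] /=; first by right; split=> // [|b]; lia.
  case: IH => [[-> h]|[h1 h2 h3]]; [left|right]; split=> //.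
  - move=> b hb; have [->//|ne] := eqVneq b (a.+1 + k).
    by apply: h; lia.
  - lia.
  - move=> b hb; have [->//|ne] := eqVneq b (a.+1 + k).
    by apply: h3; lia.
case: H => [[-> h]|[h1 h2 h3]]; split; try lia.
  move=> p q epq hp hq; have pa : p = a by lia.
  split=> //; apply/eqP; apply: contraLR epq => ne.
  by rewrite pa; apply: h; lia.
move=> p q epq hp hq; have [pa|ne] := eqVneq p a.
  split=> //; apply/eqP; apply: contraLR epq => ne.
  by rewrite pa; apply: h3; lia.
by have := e_nc h2 epq; lia.
Qed.

(* The pair counts the left and the right turns on the way from [a, c] down to
   [p, q] in the binary tree that splits every interval at its apex. *)
Fixpoint turns k a c p q : nat * nat :=
  if k is k'.+1 then
    if (p == a) && (q == c) then (0, 0) else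
    if q <= apex a c then
      let t := turns k' a (apex a c) p q in (t.1.+1, t.2)
    else let t := turns k' (apex a c) c p q in (t.1, t.2.+1)
  else (0, 0).

Variables (K i : nat).
Hypothesis ltiK : i < K.

(** The edges left after removing class [i], where [l] and [r] count the turns already made on the
    way down to [[a, c]]. The fuel [k] suffices once [c - a <= k]. *)
Definition kept k l r a c : rel nat := fun p q =>
  [&& e p q, (l + (turns k a c p q).1) %% K != i
           & (r + (turns k a c p q).2) %% K != i].

Lemma kept_lt k l r a c p q : kept k l r a c p q -> p < q.
Proof. by case/and3P=> /e_lt. Qed.

Lemma kept_left k l r a c p q : a.+1 < c -> q <= apex a c ->
  kept k.+1 l r a c p q -> kept k l.+1 r a (apex a c) p q.
Proof.
move=> lt_ac le_q; have [/andP[_ lt_b] _] := apexP lt_ac.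
rewrite /kept /= ifN; last by apply/negP=> /andP[_ /eqP]; lia.
by rewrite le_q /= addnS addSn.
Qed.

Lemma kept_right k l r a c p q : a.+1 < c -> apex a c <= p ->
  kept k.+1 l r a c p q -> kept k l r.+1 (apex a c) c p q.
Proof.
move=> lt_ac le_p; have [/andP[lt_b _] _] := apexP lt_ac.
move=> kpq; have lt_pq := kept_lt kpq; move: kpq.
rewrite /kept /= ifN; last by apply/negP=> /andP[/eqP]; lia.
by rewrite leqNgt (leq_ltn_trans le_p lt_pq) /= addnS addSn.
Qed.

Lemma kept_root k l r a c : kept k l r a c a c -> l %% K != i /\ r %% K != i.
Proof.
by case: k => [|k] /and3P[_] /=; rewrite ?eqxx /= !addn0.
Qed.

Lemma kept_jump k l r a c p q : a.+1 < c ->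
  kept k l r a c p q -> a <= p < apex a c -> apex a c < q <= c ->
  p = a /\ q = c.
Proof. by move=> /apexP[_ h] /and3P[epq _ _]; apply: h. Qed.

Lemma kept_walk k l r a c p m q : a.+1 < c -> a <= p -> q <= c ->
  walk (kept k.+1 l r a c) p m q -> p <= apex a c <= q ->
  [/\ m = 1, p = a, q = c & kept k.+1 l r a c a c] \/
  exists m1 m2, [/\ walk (kept k l.+1 r a (apex a c)) p m1 (apex a c),
    walk (kept k l r.+1 (apex a c) c) (apex a c) m2 q & m = m1 + m2].
Proof.
move=> lt_ac le_ap le_qc w /andP[le_p le_q].
have lt := @kept_lt k.+1 l r a c.
have [lt_b _] := apexP lt_ac.
case: (walk_split lt le_ap lt_b _ w le_p) => //; try lia.
- by move=> p' q'; apply: kept_jump.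
- by left.
case=> m1 [m2 [w1 w2 ->]]; right; exists m1, m2; split=> //.
  apply: (walk_sub lt (a := a) (c := apex a c)) w1 _ => // p' q' _ le'.
  exact: kept_left.
apply: (walk_sub lt (a := apex a c) (c := c)) w2 _ => // p' q' le' _.
exact: kept_right.
Qed.

Lemma walk_left k l r a c p m q : a.+1 < c -> a <= p -> q <= apex a c ->
  walk (kept k.+1 l r a c) p m q -> walk (kept k l.+1 r a (apex a c)) p m q.
Proof.
move=> lt_ac le_ap le_q w.
apply: (walk_sub (@kept_lt _ _ _ _ _) (a := a) (c := apex a c)) w le_q => //.
by move=> p' q' _ le'; apply: kept_left.
Qed.

Lemma walk_right k l r a c p m q : a.+1 < c -> apex a c <= p -> q <= c ->
  walk (kept k.+1 l r a c) p m q -> walk (kept k l r.+1 (apex a c) c) p m q.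
Proof.
move=> lt_ac le_p le_q w.
apply: (walk_sub (@kept_lt _ _ _ _ _) (a := apex a c) (c := c)) w le_q => //.
by move=> p' q' le' _; apply: kept_right.
Qed.


Lemma walk_unit k l r a c p m q : a <= p -> q <= c -> c <= a.+1 ->
  walk (kept k l r a c) p m q ->
  m = 0 \/ [/\ m = 1, p = a, q = c & kept k l r a c a c].
Proof.
move=> le_ap le_qc le_ca w; have [->|m_gt0] := posnP m; first by left.
right; case: w le_qc m_gt0 => [|{}m {}q q' w kq] le_qc //.
have lt_qq := kept_lt kq; have le_pq := walk_le (@kept_lt _ _ _ _ _) w.
have [qa pa qc] : [/\ q = a, p = a & q' = c] by split; lia.
move=> _; split=> //; last by rewrite -{2}qa -{2}qc.
by rewrite (walk_refl (@kept_lt _ _ _ _ _) w); lia.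
Qed.

(** The edge from [a] to [c] is removed, its left count being [i] modulo [K]. Any other walk passes
    the apex and then crosses the right half, where the left count is still [l]. *)
Lemma no_crossing_l k l r a c m : c - a <= k -> a < c -> l %% K = i ->
  ~ walk (kept k l r a c) a m c.
Proof.
elim: k l r a c m => [|k IH] l r a c m hk lt_ac li w; first by lia.
have nroot : ~ kept k.+1 l r a c a c by move/kept_root; rewrite li eqxx; case.
have [lt1|le1] := ltnP a.+1 c; last first.
  case: (walk_unit _ _ le1 w) => // [m0|[]//].
  by move: w; rewrite m0; move/(@walk0E _ _ _); lia.
have [lt_b _] := apexP lt1.
case: (kept_walk lt1 _ _ w) => //; first by lia.
  by case.
by case=> m1 [m2 [_ w2 _]]; apply: IH w2 => //; lia.
Qed.

Lemma no_crossing_r k l r a c m : c - a <= k -> a < c -> r %% K = i ->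
  ~ walk (kept k l r a c) a m c.
Proof.
elim: k l r a c m => [|k IH] l r a c m hk lt_ac li w; first by lia.
have nroot : ~ kept k.+1 l r a c a c by move/kept_root; rewrite li eqxx; case.
have [lt1|le1] := ltnP a.+1 c; last first.
  case: (walk_unit _ _ le1 w) => // [m0|[]//].
  by move: w; rewrite m0; move/(@walk0E _ _ _); lia.
have [lt_b _] := apexP lt1.
case: (kept_walk lt1 _ _ w) => //; first by lia.
  by case.
by case=> m1 [m2 [w1 _ _]]; apply: IH w1 => //; lia.
Qed.

(** [dl] and [dr] are distances of the counters to [i] modulo [K]. Each half of the interval lowers
    one of them by one, so the halves contribute [2 ^ (dl + dr - 1)] each; at distance 0 there is no
    crossing. *)
Lemma crossing_bound k l r dl dr a c m : c - a <= k -> a < c ->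
  (l + dl) %% K = i -> (r + dr) %% K = i ->
  walk (kept k l r a c) a m c -> m <= 2 ^ (dl + dr).
Proof.
elim: k l r dl dr a c m => [|k IH] l r dl dr a c m hk lt_ac hl hr w; first by lia.
have pos : 0 < 2 ^ (dl + dr) by rewrite expn_gt0.
case: dl hl => [|dl] hl in pos *.
  by case: (no_crossing_l hk lt_ac _ w); rewrite -hl addn0.
case: dr hr => [|dr] hr in pos *.
  by case: (no_crossing_r hk lt_ac _ w); rewrite -hr addn0.
have [lt1|le1] := ltnP a.+1 c; last first.
  by case: (walk_unit _ _ le1 w) => // [m0|[m1 _ _ _]]; lia.
have [lt_b _] := apexP lt1.
case: (kept_walk lt1 _ _ w) => //; first by lia.
  by case=> ->.
case=> m1 [m2 [w1 w2 ->]].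
have h1 : m1 <= 2 ^ (dl + dr.+1) by apply: IH w1; rewrite ?addSnnS //; lia.
have h2 : m2 <= 2 ^ (dl.+1 + dr) by apply: IH w2; rewrite ?addSnnS //; lia.
by move: h1 h2; rewrite !addSn !addnS !expnS; lia.
Qed.

Lemma residueP l : exists2 d, d <= K & (l + d) %% K = i.
Proof.
have K_gt0 : 0 < K by lia.
exists ((i + (K - l %% K)) %% K); first exact/ltnW/ltn_pmod.
rewrite modnDmr addnCA.
have -> : i + (l + (K - l %% K)) = (l %/ K).+1 * K + i.
  have := divn_eq l K; have := ltn_pmod l K_gt0; lia.
by rewrite modnMDl modn_small.
Qed.

Lemma crossing_bound_unif k l r a c m : c - a <= k -> a < c ->
  walk (kept k l r a c) a m c -> m <= 2 ^ (K + K).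
Proof.
move=> hk lt_ac w; have [dl le_dl hl] := residueP l.
have [dr le_dr hr] := residueP r.
apply: leq_trans (crossing_bound hk lt_ac hl hr w) _.
by rewrite leq_exp2l // leq_add.
Qed.

(** Apart from the edge from [a] to [c], a walk starting before the apex is a suffix of the left
    half, where [dl] drops by one, followed by a crossing of the right half. A walk starting past it
    stays in the right half, with the same [dl]. *)
Lemma suffix_bound k l r dl a c p m : c - a <= k -> a < c -> a <= p ->
  (l + dl) %% K = i -> walk (kept k l r a c) p m c -> m <= dl * 2 ^ (K + K).
Proof.
set B := 2 ^ (K + K); have B_gt0 : 0 < B by rewrite expn_gt0.
elim: k l r dl a c p m => [|k IH] l r dl a c p m hk lt_ac le_ap hl w; first by lia.
have root_dl : kept k.+1 l r a c a c -> 0 < dl.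
  by case: dl hl => // hl /kept_root[]; rewrite -hl addn0 eqxx.
have [lt1|le1] := ltnP a.+1 c; last first.
  by case: (walk_unit _ _ le1 w) => // [m0|[m1 _ _ /root_dl]]; nia.
have [lt_b _] := apexP lt1.
have [le_p|lt_p] := leqP (apex a c) p.
  by apply: IH (walk_right lt1 le_p (leqnn c) w) => //; lia.
case: (kept_walk lt1 _ _ w) => //; first by lia.
  by case=> -> _ _ /root_dl; nia.
case=> m1 [m2 [w1 w2 ->]].
case: dl hl {root_dl} => [|dl] hl.
  by case: (no_crossing_l _ _ _ w2); rewrite -?hl ?addn0 //; lia.
have h1 : m1 <= dl * B by apply: IH w1; rewrite ?addSnnS //; lia.
have h2 : m2 <= B by apply: crossing_bound_unif w2; lia.
by lia.
Qed.

(** The mirror image: going left keeps [dr], going right lowers it by one. *)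
Lemma prefix_bound k l r dr a c m q : c - a <= k -> a < c -> q <= c ->
  (r + dr) %% K = i -> walk (kept k l r a c) a m q -> m <= dr * 2 ^ (K + K).
Proof.
set B := 2 ^ (K + K); have B_gt0 : 0 < B by rewrite expn_gt0.
elim: k l r dr a c q m => [|k IH] l r dr a c q m hk lt_ac le_qc hr w; first by lia.
have root_dr : kept k.+1 l r a c a c -> 0 < dr.
  by case: dr hr => // hr /kept_root[_]; rewrite -hr addn0 eqxx.
have [lt1|le1] := ltnP a.+1 c; last first.
  by case: (walk_unit _ _ le1 w) => // [m0|[m1 _ _ /root_dr]]; nia.
have [lt_b _] := apexP lt1.
have [le_q|lt_q] := leqP q (apex a c).
  by apply: IH (walk_left lt1 (leqnn a) le_q w) => //; lia.
case: (kept_walk lt1 _ _ w) => //; first by lia.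
  by case=> -> _ _ /root_dr; nia.
case=> m1 [m2 [w1 w2 ->]].
case: dr hr {root_dr} => [|dr] hr.
  by case: (no_crossing_r _ _ _ w1); rewrite -?hr ?addn0 //; lia.
have h1 : m1 <= B by apply: crossing_bound_unif w1; lia.
have h2 : m2 <= dr * B by apply: IH w2; rewrite ?addSnnS //; lia.
by lia.
Qed.

(** Descend until the apex separates the two ends. The walk is then a single edge, or a suffix of
    the left half followed by a prefix of the right half. *)
Lemma walk_bound k l r a c p m q : c - a <= k -> a <= p -> q <= c ->
  walk (kept k l r a c) p m q -> m <= 2 * (K * 2 ^ (K + K)).
Proof.
have pos : 0 < K * 2 ^ (K + K) by rewrite muln_gt0 expn_gt0; lia.
elim: k l r a c p m q => [|k IH] l r a c p m q hk le_ap le_qc w.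
  by rewrite (walk_refl (@kept_lt _ _ _ _ _) w); lia.
have [lt1|le1] := ltnP a.+1 c; last first.
  by case: (walk_unit _ _ le1 w) => // [m0|[m1 _ _ _]]; lia.
have [lt_b _] := apexP lt1.
have [le_p|lt_p] := leqP (apex a c) p.
  by apply: IH (walk_right lt1 le_p le_qc w) => //; lia.
have [le_q|lt_q] := leqP q (apex a c).
  by apply: IH (walk_left lt1 le_ap le_q w) => //; lia.
case: (kept_walk lt1 _ _ w) => //; [lia | by case=> -> *; lia |].
case=> m1 [m2 [w1 w2 ->]].
have [dl le_dl hl] := residueP l.+1; have [dr le_dr hr] := residueP r.+1.
have h1 : m1 <= dl * 2 ^ (K + K) by apply: suffix_bound hl w1; lia.
have h2 : m2 <= dr * 2 ^ (K + K) by apply: prefix_bound hr w2; lia.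
by nia.
Qed.

End Noncrossing.

End NoncrossingWalks.

(** * Circuits and cuts *)

Section FoldRcons.
Variables (T G : Type) (h : seq T -> G -> T) (x0 : T) (g0 : G).
Let F (s : seq T) g := rcons s (h s g).
Local Open Scope nat_scope.

Lemma size_foldl_rcons s gs : size (foldl F s gs) = size s + size gs.
Proof. by elim: gs s => [|g gs IH] s /=; rewrite ?addn0 // IH size_rcons addSnnS. Qed.

Lemma nth_foldl_rcons s gs j : j < size s -> nth x0 (foldl F s gs) j = nth x0 s j.
Proof.
elim: gs s => //= g gs IH s lt_j; rewrite IH ?size_rcons 1?ltnW //.
by rewrite nth_rcons lt_j.
Qed.

Lemma nth_foldl_rconsE s gs i : i < size gs ->
  nth x0 (foldl F s gs) (size s + i) =
  h (foldl F s (take i gs)) (nth g0 gs i).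
Proof.
move=> lt_i; rewrite -{1}(cat_take_drop i gs) (drop_nth g0) // foldl_cat /=.
set s' := foldl F s (take i gs).
have s's : size s' = size s + i by rewrite size_foldl_rcons size_takel // ltnW.
rewrite nth_foldl_rcons /F; last by rewrite size_rcons s's.
by rewrite nth_rcons s's ltnn eqxx.
Qed.

Lemma nth_foldl_take s gs i j : j < size s + i -> i <= size gs ->
  nth x0 (foldl F s (take i gs)) j = nth x0 (foldl F s gs) j.
Proof.
move=> lt_j le_i; rewrite -{2}(cat_take_drop i gs) foldl_cat.
by rewrite [RHS]nth_foldl_rcons // size_foldl_rcons size_takel.
Qed.

End FoldRcons.

Section Circuit.
Variables (n : nat) (C : circuit n).
Local Open Scope nat_scope.

Definition gate_at j := nth (Gate andb 0 0) (gates C) (j - n).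
Definition lwire j := gate_l (gate_at j).
Definition rwire j := gate_r (gate_at j).
Definition value j x := nth false (circuit_values C x) j.
Definition depth j := nth 0 (circuit_depths C) j.
Definition is_gate j := n <= j < n + circuit_size C.

Lemma onth_gate j : is_gate j -> onth (gates C) (j - n) = Some (gate_at j).
Proof.
move=> /andP[le_j lt_j]; rewrite /gate_at onthE (nth_map (Gate andb 0 0)) //.
by rewrite /circuit_size in lt_j; lia.
Qed.

Lemma wire_lt j : is_gate j -> lwire j < j /\ rwire j < j.
Proof.
move=> gj; have := gates_acyclic (onth_gate gj); case/andP: gj => le_j _.
by rewrite subnKC.
Qed.

Lemma value_input (i : 'I_n) x : value i x = tnth x i.
Proof.
rewrite /value /circuit_values (nth_foldl_rcons _ false) ?size_tuple //.
by rewrite (tnth_nth false).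
Qed.

Lemma value_gate j x : is_gate j ->
  value j x = gate_op (gate_at j) (value (lwire j) x) (value (rwire j) x).
Proof.
move=> gj; have [lt_l lt_r] := wire_lt gj; case/andP: gj => le_j lt_j.
have lt_s : j - n < size (gates C) by move: lt_j; rewrite /circuit_size; lia.
pose h vs g := gate_op g (nth false vs (gate_l g)) (nth false vs (gate_r g)).
have := nth_foldl_rconsE h false (Gate andb 0 0) x lt_s.
rewrite size_tuple subnKC // -/(gate_at j) /value /circuit_values => ->.
rewrite {1}/h !(nth_foldl_take h false) // ?size_tuple ?subnKC //; exact: ltnW.
Qed.

Lemma depth_gate j : is_gate j ->
  depth j = (maxn (depth (lwire j)) (depth (rwire j))).+1.
Proof.
move=> gj; have [lt_l lt_r] := wire_lt gj; case/andP: gj => le_j lt_j.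
have lt_s : j - n < size (gates C) by move: lt_j; rewrite /circuit_size; lia.
pose h ds g := (maxn (nth 0 ds (gate_l g)) (nth 0 ds (gate_r g))).+1.
have := nth_foldl_rconsE h 0 (Gate andb 0 0) (nseq n 0) lt_s.
rewrite size_nseq subnKC // -/(gate_at j) /depth /circuit_depths => ->.
rewrite {1}/h !(nth_foldl_take h 0) // ?size_nseq ?subnKC //; exact: ltnW.
Qed.

End Circuit.

Section CircuitBounds.
Variables (R : realType) (n : nat) (C : circuit n) (f : boolfun n).
Hypothesis Cf : computes C f.

Lemma circuit_size_bound (M : R) : correlation_bound f 16 M ->
  2 ^+ n <= budget (circuit_size C)%:R * M.
Proof.
move=> fM; pose N := (n + circuit_size C)%N.
(* Without inputs a first gate would have no earlier vertex to read, so there would be no vertex to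
   serve as output. *)
have n_gt0 : (0 < n)%N.
  have [n0|//] := posnP n.
  have gi : ~ exists g, onth (gates C) 0 = Some g.
    by case=> g /gates_acyclic[]; rewrite n0.
  have : (0 < n + size (gates C))%N := leq_ltn_trans (leq0n _) (output_lt C).
  case E: (gates C) => [|g gs]; first by rewrite n0.
  by case: gi; exists g; rewrite E.
pose v (j : 'I_N) := value C j.
pose A : {set 'I_N} := [set j : 'I_N | (n <= j)%N]%SET.
have cA : (#|A| <= circuit_size C)%N.
  have -> : #|A| = (N - #|~: A|)%N by rewrite cardsCs card_ord.
  have -> : #|~: A| = n; last by rewrite /N addKn.
  rewrite -[RHS]card_ord -(card_imset _ (@lshift_inj n (circuit_size C))).
  apply: eq_card => j; rewrite !inE -ltnNge; apply/idP/imsetP => [lt|[i _ ->]]; last exact: (ltn_ord i).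
  by exists (Ordinal lt) => //; apply: val_inj.
have lt_w (j : 'I_N) : (n <= j)%N -> is_gate C j.
  by move=> le; rewrite /is_gate le ltn_ord.
have wl (j : 'I_N) : exists t : 'I_N * 'I_N,
    (n <= j)%N -> t.1 = lwire C j :> nat /\ t.2 = rwire C j :> nat.
  have [/lt_w/wire_lt[lt_l lt_r]|_] := boolP (n <= j)%N; last by exists (j, j).
  by exists (Ordinal (ltn_trans lt_l (ltn_ord j)), Ordinal (ltn_trans lt_r (ltn_ord j))).
have [g gP] := choice wl.
have -> : 2 ^+ n = #|(xpredT : pred (n.-tuple bool))|%:R :> R.
  by rewrite card_tuple card_bool natrX.
apply: le_trans (_ : _ <= budget #|A|%:R * M) _; last first.
  by rewrite ler_wpM2r ?(correlation_bound_ge0 fM) // ler_budget // ler_nat.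
have v_in (i : 'I_N) : (i < n)%N -> low_degree 1 (v i).
  move=> lt_i; have := low_degree_var (Ordinal lt_i).
  by congr (low_degree 1); apply/funext => x; exact/esym/(value_input C (Ordinal lt_i)).
apply: (@elimination_bound R n N v f M n_gt0 fM v_in xpredT A
  (fun j => gate_op (gate_at C j)) (fun j => (g j).1) (fun j => (g j).2)).
- exact: polysetT.
- move=> j; rewrite inE => le_j; have [el er] := gP j le_j.
  have gj := lt_w j le_j; have [lt_l lt_r] := wire_lt gj; split.
    by split; rewrite ?el ?er // /avail inE ?el ?er; case: ltnP.
  by move=> x _; rewrite /v el er value_gate.
- exists (Ordinal (output_lt C)), id; split; last by move=> x _; rewrite -Cf.
  by rewrite /avail inE; case: ltnP.
Qed.

(** * Guessing the tails of removed edges *)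

Section Cut.
Variables (d T : nat) (M : R) (Q : pred nat).
Hypotheses (fM : correlation_bound f d M) (Td : (2 ^ T <= d)%N).
Hypothesis (Qout : Q (output C)).
Hypothesis (Qwire : forall j, is_gate C j -> Q j -> Q (lwire C j) /\ Q (rwire C j)).

(** Guess the vertices of [G] in topological order. Once those below [j] are known, the value of [j]
    has degree at most [2 ^ rho j]: a gate at most doubles the degree, and [rho] grows along every
    wire that is not guessed. *)
Lemma cut_bound (rho : nat -> nat) (G : seq nat) :
    (forall j, Q j -> (rho j <= T)%N) -> {subset G <= Q} ->
    (forall j, is_gate C j -> Q j ->
       (lwire C j \in G \/ (rho (lwire C j) < rho j)%N) /\
       (rwire C j \in G \/ (rho (rwire C j) < rho j)%N)) ->
  2 ^+ n <= 2 ^+ size G * M.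
Proof.
move=> rhoT GQ kept; pose N := (n + circuit_size C)%N.
have M0 : 0 <= M := le_trans (normr_ge0 _) (fM (low_degree_cst n d false)).
have deg (S : pred (n.-tuple bool)) m :
    (forall u, u \in G -> (u < m)%N -> exists b, forall x, S x -> value C u x = b) ->
    forall j, (j < N)%N -> (j <= m)%N -> Q j -> low_degree_on S (2 ^ rho j) (value C j).
  move=> cst j; have [k] := ubnP j; elim: k j => // k IHk j lek ltN le_m Qj.
  have [lt_n|le_n] := ltnP j n.
    exists (value C j) => //; apply: (@low_degreeW _ 1); first by rewrite expn_gt0.
    have := low_degree_var (Ordinal lt_n).
    congr (low_degree 1); apply/funext => x; exact/esym/(value_input C (Ordinal lt_n)).
  have gj : is_gate C j by rewrite /is_gate le_n.
  have [lt_l lt_r] := wire_lt gj; have [Ql Qr] := Qwire gj Qj.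
  have wire u : (u < j)%N -> Q u -> u \in G \/ (rho u < rho j)%N ->
      low_degree_on S (2 ^ (rho j).-1) (value C u).
    move=> lt_u Qu [uG|lt_rho].
      have [b eb] := cst u uG (leq_trans lt_u le_m); exact: low_degree_on_cst eb.
    apply: low_degree_onW (IHk u _ _ _ Qu); rewrite ?leq_exp2l //; by lia.
  have [kl kr] := kept j gj Qj.
  have ll := wire _ lt_l Ql kl; have lr := wire _ lt_r Qr kr.
  (* At height 0 the truncated [(rho j).-1] gains nothing, but both wires are then guessed and the
     gate is constant on [S]. *)
  case E: (rho j) ll lr => [|t] ll lr.
    have cu u : (u < j)%N -> u \in G \/ (rho u < rho j)%N ->
        low_degree_on S 0 (value C u).
      move=> lt_u [uG|]; last by rewrite E.
      have [b eb] := cst u uG (leq_trans lt_u le_m); exact: low_degree_on_cst eb.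
    apply: low_degree_onW (low_degree_on_op (cu _ lt_l kl) (cu _ lt_r kr)
      (fun x _ => value_gate x gj)); by [].
  rewrite expnS mul2n -addnn.
  exact: low_degree_on_op ll lr (fun x _ => value_gate x gj).
have degT (S : pred (n.-tuple bool)) m (cst : forall u, u \in G -> (u < m)%N ->
     exists b, forall x, S x -> value C u x = b) j :
    (j < N)%N -> (j <= m)%N -> Q j -> low_degree_on S d (value C j).
  move=> ltN le_m Qj; apply: low_degree_onW (deg S m cst j ltN le_m Qj).
  by apply: leq_trans Td; rewrite leq_exp2l // rhoT.
have main k m (S : pred (n.-tuple bool)) : (m + k = N)%N -> polyset d S ->
    (forall u, u \in G -> (u < m)%N -> exists b, forall x, S x -> value C u x = b) ->
    #|S|%:R <= 2 ^+ count (mem G) (iota m k) * M.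
  elim: k m S => [|k IHk] m S mk pS cst.
    rewrite mul1r; apply: (polyset_leaf fM pS).
    have lt_o := output_lt C; rewrite addn0 in mk.
    have [h lh e] := degT S m cst (output C) lt_o (ltnW (leq_trans lt_o (eq_leq (esym mk)))) Qout.
    by exists h => // x Sx; rewrite -e // -Cf.
  rewrite /=; have [mG|mG] := boolP (m \in G); last first.
    rewrite add0n; apply: IHk => //; first by rewrite addSnnS.
    move=> u uG; rewrite ltnS leq_eqVlt => /predU1P[um|]; last exact: cst.
    by rewrite -um uG in mG.
  have lm : low_degree_on S d (value C m).
    by apply: (degT S m cst) => //; [lia | exact: GQ].
  rewrite (card_guess S (value C m)) natrD exprS -mulrA mulrDl mul1r.
  have br b : #|guess S (value C m) b|%:R <= 2 ^+ count (mem G) (iota m.+1 k) * M.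
    apply: IHk; [by rewrite addSnnS | exact: polyset_guess |].
    move=> u uG; rewrite ltnS leq_eqVlt => /predU1P[->|lt_um].
      by exists b => x /andP[_ /eqP].
    by have [b' eb] := cst u uG lt_um; exists b' => x /andP[Sx _]; apply: eb.
  by rewrite lerD.
have -> : 2 ^+ n = #|(xpredT : pred (n.-tuple bool))|%:R :> R.
  by rewrite card_tuple card_bool natrX.
apply: le_trans (main N 0%N _ (add0n N) (polysetT _ _) _) _ => //.
rewrite ler_wpM2r // ler_weXn2l ?ler1n //.
(* [G] may repeat a vertex, which is guessed only once. *)
rewrite -size_filter; apply: uniq_leq_size; first by rewrite filter_uniq ?iota_uniq.
by move=> u; rewrite mem_filter => /andP[].
Qed.

(** Averaging: each gate has two wires, each wire lies in at most [w] of the [K] classes, and the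
    tails of the wires in a smallest class are guessed. *)
Lemma cut_classes (K w : nat) (cls : nat -> nat -> nat -> bool) : (0 < K)%N ->
    (forall u j, (\sum_(i < K) cls i u j <= w)%N) ->
    (forall i, (i < K)%N -> exists rho : nat -> nat,
      (forall j, Q j -> (rho j <= T)%N) /\
      forall j, is_gate C j -> Q j ->
        (cls i (lwire C j) j || (rho (lwire C j) < rho j)%N) /\
        (cls i (rwire C j) j || (rho (rwire C j) < rho j)%N)) ->
  exists2 g, (K * g <= 2 * w * circuit_size C)%N & 2 ^+ n <= 2 ^+ g * M.
Proof.
move=> K_gt0 cls_w cut; set s := circuit_size C.
pose tail (e : nat * bool) := if e.2 then lwire C e.1 else rwire C e.1.
pose edges := [seq (j, b) | j <- iota n s, b <- [:: true; false]].
pose G i := [seq tail e | e <- edges & Q e.1 && cls i (tail e) e.1].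
have size_edges : size edges = (2 * s)%N by rewrite size_allpairs size_iota mulnC.
have edgeP j b : is_gate C j -> (j, b) \in edges.
  by move=> /andP[le lt]; apply/allpairsP; exists (j, b); rewrite mem_iota le lt; case: b.
have sumG : (\sum_(i < K) size (G i) <= 2 * w * s)%N.
  under eq_bigr => i _ do rewrite size_map size_filter -sum1_count big_mkcond.
  rewrite exchange_big /= mulnAC -size_edges -sum1_size big_distrl /=.
  apply: leq_sum => e _; rewrite mul1n; apply: leq_trans (cls_w (tail e) e.1).
  by apply: leq_sum => i _; case: (Q _); case: (cls _ _ _).
have [i Ki] : exists i : 'I_K, (K * size (G i) <= 2 * w * s)%N.
  apply: contrapT => /forallNP h.
  have : (\sum_(i < K) (2 * w * s).+1 <= K * \sum_(i < K) size (G i))%N.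
    by rewrite big_distrr; apply: leq_sum => i _; rewrite ltnNge; apply/negP/h.
  by rewrite sum_nat_const card_ord leqNgt; move/negP; apply; nia.
exists (size (G i)) => //.
have [rho [rhoT kept]] := cut i (ltn_ord i).
apply: cut_bound rhoT _ _.
  move=> u /mapP[e]; rewrite mem_filter => /andP[/andP[Qe _] /allpairsP[[j b] [je _ ee]]] ->.
  have gj : is_gate C j by move: je; rewrite /= mem_iota.
  rewrite ee /= in Qe *; have [Ql Qr] := Qwire gj Qe.
  by rewrite /tail; case: (b).
move=> j gj Qj; have [kl kr] := kept j gj Qj; split.
  case/orP: kl => [cl|]; [left|by right].
  by apply/mapP; exists (j, true) => //; rewrite mem_filter /= Qj /tail /= cl edgeP.
case/orP: kr => [cr|]; [left|by right].
by apply/mapP; exists (j, false) => //; rewrite mem_filter /= Qj /tail /= cr edgeP.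
Qed.

End Cut.
End CircuitBounds.

Lemma sum_le1 K (P : nat -> bool) :
  (forall i j, i < j -> P i -> P j -> false)%N -> (\sum_(i < K) P i <= 1)%N.
Proof.
move=> Pu; have -> : (\sum_(i < K) P i = #|[pred i : 'I_K | P i]|)%N.
  by rewrite -sum1_card [RHS]big_mkcond; apply: eq_bigr => i _; rewrite inE; case: (P i).
apply/card_le1_eqP => i j; rewrite !inE => Pi Pj; apply: val_inj.
by have [lt|lt|] := ltngtP i j => //; have := Pu _ _ lt; rewrite Pi Pj => /(_ isT isT).
Qed.

Definition sp_height K := (2 * (K * 2 ^ (K + K)))%N.

(** A wire lies in class [i] when its left or its right turn count is [i] modulo [K], hence in at
    most two classes. The height [rho] is the length of a longest remaining walk ending at the
    label. *)
Lemma series_parallel_cut (R : realType) n (C : circuit n) f (M : R) K :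
    computes C f -> series_parallel C -> (0 < K)%N ->
    correlation_bound f (2 ^ sp_height K) M ->
  exists2 g, (K * g <= 4 * circuit_size C)%N & 2 ^+ n <= 2 ^+ g * M.
Proof.
move=> Cf [l [l_lt l_nc]] K_gt0 fM.
pose lab j := if insub j is Some u then l u else 0%N.
pose e p q := `[< exists u v : vertex C, [/\ edge u v, l u = p & l v = q] >].
have e_lt p q : e p q -> (p < q)%N by case/asboolP=> u [w [euw <- <-]]; apply: l_lt.
have e_nc p q p' q' : e p q -> e p' q' -> ~~ [&& p < p', p' < q & q < q']%N.
  case/asboolP=> u [w [euw <- <-]] /asboolP[u' [w' [euw' <- <-]]].
  by apply/negP=> /and3P[h1 h2 h3]; apply: l_nc; exists u, w, u', w'.
pose c := (\max_(u : vertex C) l u)%N.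
have lab_le j : (lab j <= c)%N.
  by rewrite /lab; case: insub => // u; rewrite /c (bigD1 u) //= leq_maxl.
have e_wire j u : is_gate C j -> u = lwire C j \/ u = rwire C j -> e (lab u) (lab j).
  move=> gj hu; have [lt_l lt_r] := wire_lt gj.
  have lt_j : (j < n + circuit_size C)%N by case/andP: gj.
  have lt_u : (u < n + circuit_size C)%N by apply: ltn_trans lt_j; case: hu => ->.
  rewrite /lab !insubT /=; apply/asboolP.
  exists (Ordinal lt_u), (Ordinal lt_j); split=> //.
  exists (j - n)%N, (gate_at C j); split=> //=; first exact: onth_gate.
  by rewrite subnKC //; case/andP: gj.
pose t u j := turns e c 0 c (lab u) (lab j).
pose cls i u j := ((t u j).1 %% K == i)%N || ((t u j).2 %% K == i)%N.
rewrite (_ : 4 = 2 * 2)%N //.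
apply: (@cut_classes R n C f Cf (2 ^ sp_height K) (sp_height K) M xpredT fM _ _ _ K 2 cls) => //.
  move=> u j; apply: (@leq_trans (\sum_(i < K) (((t u j).1 %% K == i) : nat) +
      \sum_(i < K) (((t u j).2 %% K == i) : nat))%N).
    by rewrite -big_split; apply: leq_sum => i _; rewrite /cls; do 2!case: (_ == _).
  by rewrite (@leq_add _ _ 1 1) // sum_le1 // => i i' + /eqP Ei /eqP Ei'; rewrite -Ei -Ei' ltnn.
move=> i lt_i.
pose ke := kept e K i c 0 0 0 c.
have /choice[rho rhoP] : forall j, exists r, (exists p, walk ke p r (lab j)) /\
    forall p m, walk ke p m (lab j) -> (m <= r)%N.
  move=> j.
  have ex : exists m, `[< exists p, walk ke p m (lab j) >].
    by exists 0%N; apply/asboolP; exists (lab j); exact: walk0.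
  have bd m : `[< exists p, walk ke p m (lab j) >] -> (m <= sp_height K)%N.
    by case/asboolP=> p; apply: (walk_bound e_lt e_nc lt_i); rewrite ?subn0.
  exists (ex_maxn ex bd); case: ex_maxnP => m /asboolP mP mmax; split=> // p m' w.
  by apply: mmax; apply/asboolP; exists p.
exists rho; split=> [j _|j gj _].
  have [[p w] _] := rhoP j.
  by apply: (walk_bound e_lt e_nc lt_i _ _ _ w); rewrite ?subn0.
have wire u : u = lwire C j \/ u = rwire C j -> cls i u j || (rho u < rho j)%N.
  move=> hu; case: (boolP (cls i u j)) => //= ncls.
  have [[p w] _] := rhoP u; have [_ rmax] := rhoP j.
  apply: (rmax p); apply: walkS w _; rewrite /ke /kept e_wire //= !add0n.
  by move: ncls; rewrite negb_or.
by split; apply: wire; [left|right].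
Qed.

(** * Deleting a digit of the depths *)

Section DeleteDigit.
Variables (B i : nat).
Hypothesis B_gt0 : (0 < B)%N.
Local Open Scope nat_scope.

(* Removes the digit of weight [B ^ i] from the base-[B] expansion. *)
Definition delete_digit x := x %/ B ^ i.+1 * B ^ i + x %% B ^ i.

(** The order is decided at the most significant digit in which [x] and [y] differ. By hypothesis
    this is not digit [i], so it survives. *)
Lemma delete_digit_lt x y : x < y ->
  x %/ B ^ i.+1 != y %/ B ^ i.+1 \/ x %/ B ^ i = y %/ B ^ i ->
  delete_digit x < delete_digit y.
Proof.
have Bi_gt0 : 0 < B ^ i by rewrite expn_gt0 B_gt0.
move=> lt_xy; rewrite /delete_digit => -[ne|eq_i].
  have lt_d : x %/ B ^ i.+1 < y %/ B ^ i.+1 by rewrite ltn_neqAle ne leq_div2r // ltnW.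
  apply: leq_trans (leq_addr _ _).
  apply: (@leq_trans ((x %/ B ^ i.+1).+1 * B ^ i)); last by rewrite leq_mul2r lt_d orbT.
  by rewrite mulSn addnC ltn_add2r ltn_pmod.
rewrite expnSr !divnMA eq_i ltn_add2l.
by move: lt_xy; rewrite {1}(divn_eq x (B ^ i)) {1}(divn_eq y (B ^ i)) eq_i ltn_add2l.
Qed.

Lemma delete_digit_bound D X K x : i < K -> D < X * B ^ K -> x <= D ->
  delete_digit x <= X * B ^ K.-1.
Proof.
move=> lt_iK lt_D le_x; have Bi_gt0 : 0 < B ^ i by rewrite expn_gt0 B_gt0.
have lt_d : x %/ B ^ i.+1 < X * B ^ (K - i.+1).
  rewrite ltn_divLR ?expn_gt0 ?B_gt0 // -mulnA -expnD subnK //.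
  exact: leq_ltn_trans lt_D.
apply: (@leq_trans ((x %/ B ^ i.+1).+1 * B ^ i)).
  by rewrite /delete_digit mulSn addnC leq_add2r ltnW ?ltn_pmod.
apply: (@leq_trans (X * B ^ (K - i.+1) * B ^ i)); first by rewrite leq_mul2r lt_d orbT.
by rewrite -mulnA -expnD (_ : K - i.+1 + i = K.-1) //; lia.
Qed.

End DeleteDigit.

(* Valiant's depth reduction: an edge is cut in class [i] when the most
   significant digit in which the depths of its endpoints differ is the [i]-th. *)
Lemma depth_cut (R : realType) n (C : circuit n) f (M : R) K X B D :
    computes C f -> (0 < K)%N -> (0 < B)%N ->
    (circuit_depth C <= D)%N -> (D < X * B ^ K)%N ->
    correlation_bound f (2 ^ (X * B ^ K.-1)) M ->
  exists2 g, (K * g <= 2 * circuit_size C)%N & 2 ^+ n <= 2 ^+ g * M.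
Proof.
move=> Cf K_gt0 B_gt0 le_D lt_D fM.
pose cls i u j := (depth C u %/ B ^ i.+1 == depth C j %/ B ^ i.+1)%N &&
  (depth C u %/ B ^ i != depth C j %/ B ^ i)%N.
(* [circuit_depth] bounds the depth of the output only, and other gates may be deeper. The vertices
   of depth at most [D] are closed under predecessors. *)
pose Q := [pred j | depth C j <= D]%N.
rewrite (_ : 2 = 2 * 1)%N //.
have Qw j : is_gate C j -> Q j -> Q (lwire C j) /\ Q (rwire C j).
  by move=> gj; rewrite /Q /= (depth_gate gj) gtn_max => /andP[/ltnW ? /ltnW].
apply: (@cut_classes R n C f Cf (2 ^ (X * B ^ K.-1)) (X * B ^ K.-1) M Q fM _ _ _ K 1 cls) => //.
  move=> u j; apply: (@sum_le1 K (fun i => cls i u j)) => i i' lt_i /andP[/eqP e1 _] /andP[_ /negP]; case.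
  by rewrite -(subnKC lt_i) expnD !divnMA e1.
move=> i lt_i; exists (fun j => delete_digit B i (depth C j)); split=> [j Qj|j gj Qj].
  exact: delete_digit_bound lt_D Qj.
have wire u : (depth C u < depth C j)%N ->
    cls i u j || (delete_digit B i (depth C u) < delete_digit B i (depth C j))%N.
  move=> lt_uj; case: (boolP (cls i u j)) => //=; rewrite negb_and negbK => h.
  by apply: delete_digit_lt => //; case/orP: h => [|/eqP]; [left|right].
by split; apply: wire; rewrite (depth_gate gj) ltnS ?leq_maxl ?leq_maxr.
Qed.

(** * Asymptotics *)

Section Asymptotics.
Variable R : realType.
Implicit Types (x y z c g eps : R).

Lemma ln2_gt0 : 0 < ln 2 :> R.
Proof. by rewrite ln_gt0 // ltr1n. Qed.

Lemma log2K x : 0 < x -> 2 `^ log2 x = x.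
Proof.
move=> x_gt0; rewrite /powR pnatr_eq0 /= /log2 divfK ?lnK ?posrE //.
by rewrite gt_eqF ?ln2_gt0.
Qed.

Lemma ler_log2 x y : 0 < x -> x <= y -> log2 x <= log2 y.
Proof.
move=> x_gt0 le_xy; rewrite ler_pM2r ?invr_gt0 ?ln2_gt0 // ler_ln ?posrE //.
exact: lt_le_trans le_xy.
Qed.

Lemma log2X x k : 0 < x -> log2 (x ^+ k) = k%:R * log2 x.
Proof. by move=> x_gt0; rewrite /log2 lnXn // -(mulr_natl (ln x) k) mulrA. Qed.

Lemma log2_gt0 x : 1 < x -> 0 < log2 x.
Proof. by move=> x_gt1; rewrite divr_gt0 ?ln_gt0 ?ltr1n. Qed.

Lemma log2_unbounded z : \forall n \near \oo, z <= log2 n%:R.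
Proof.
apply: filterS (nbhs_infty_ger (2 `^ z)) => n le_n.
have -> : z = log2 (2 `^ z) by rewrite /log2 ln_powR mulfK // gt_eqF ?ln2_gt0.
by apply: ler_log2 le_n; rewrite powR_gt0.
Qed.

Lemma correlation_exponent n (cor g y : R) :
  2 ^+ n <= 2 `^ g * (2 ^+ n * cor) -> cor <= 2 `^ (- y) -> y <= g.
Proof.
move=> le_n le_cor; have p2 : 0 < 2 ^+ n :> R by rewrite exprn_gt0.
have : 1 <= 2 `^ (g - y).
  rewrite powRD ?pnatr_eq0 ?implybT //.
  apply: le_trans (_ : _ <= 2 `^ g * cor) _; last by rewrite ler_wpM2l ?powR_ge0.
  by rewrite -(ler_pM2l p2) mulr1 mulrCA.
by move/ln_ge0; rewrite ln_powR pmulr_lge0 ?ln2_gt0 // subr_ge0.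
Qed.

Lemma exprn_powR2 (k : nat) : 2 ^+ k = 2 `^ k%:R :> R.
Proof. by rewrite powR_mulrn. Qed.

Lemma circuit_size_of_cor16 eps n (f : boolfun n) :
  Cor_deg f 16 <= 2 `^ (- (n%:R * (1 - eps))) ->
  ((39 / 10 * (1 - eps) * n%:R - 4)%:E <= min_circuit_size R f)%E.
Proof.
move=> hcor; apply/ereal_infP => _ [C Cf <-]; rewrite lee_fin.
have cb := Cor_degP f (lexx (16 : R)).
by have := correlation_exponent (circuit_size_bound Cf cb) hcor; lra.
Qed.

Lemma cut_exponent n (f : boolfun n) r y (g : nat) :
  2 ^+ n <= 2 ^+ g * (2 ^+ n * Cor_deg f r) ->
  Cor_deg f r <= 2 `^ (- y) -> y <= g%:R.
Proof. by rewrite exprn_powR2; apply: correlation_exponent. Qed.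

Lemma sp_superlinear_of_cor eps (f : forall n, boolfun n) : 0 < eps ->
    (forall d : nat, \forall n \near \oo,
        Cor_deg (f n) d%:R <= 2 `^ (- (eps * n%:R))) ->
  ssp_superlinear R f.
Proof.
move=> eps_gt0 hcor c; pose c1 := `|c| + 1.
have c1_ge : c <= c1 by rewrite /c1; have := ler_norm c; lra.
have c1_gt0 : 0 < c1 by rewrite /c1; have := normr_ge0 c; lra.
(* With [4 * c1 / K < eps] the cut has fewer than [eps * n] members, too few for the correlation
   bound. *)
pose K := (Num.bound (4 * c1 / eps)).+1.
have K_gt : 4 * c1 < K%:R * eps.
  rewrite -ltr_pdivrMr //; apply: lt_trans (archi_boundP _) _; last by rewrite ltr_nat.
  by rewrite divr_ge0 ?mulr_ge0 // ltW.
move: (hcor (2 ^ sp_height K)%N) (nbhs_infty_ge 1); apply: filterS2 => n hn n_gt0.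
move=> [C [Cf Csp le_s]].
have cb := Cor_degP (f n) (lexx ((2 ^ sp_height K)%N%:R : R)).
have [g le_g le_n] := series_parallel_cut Cf Csp (ltn0Sn _) cb.
have le_eg := cut_exponent le_n hn.
have n0 : 0 < n%:R :> R by rewrite ltr0n.
have le_g' : K%:R * g%:R <= 4 * (circuit_size C)%:R :> R.
  by rewrite -!natrM ler_nat.
have : K%:R * (eps * n%:R) <= 4 * (c1 * n%:R).
  apply: le_trans (_ : _ <= K%:R * g%:R) _; first by rewrite ler_wpM2l.
  apply: le_trans le_g' _; rewrite ler_wpM2l //.
  by apply: le_trans le_s _; rewrite ler_wpM2r // ltW.
by rewrite !mulrA ler_pM2r // leNgt K_gt.
Qed.

(** For the least such [B], [(B - 1) ^ K <= D], and [B <= 2 * (B - 1)] as soon as [B > 1]. *)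
Lemma valiant_base c1 K D : (0 < K)%N -> exists B, [/\ (0 < B)%N, (D < B ^ K)%N &
  1 <= c1 -> D%:R <= c1 -> (B%:R : R) ^+ K <= 2 ^+ K * c1].
Proof.
move=> K_gt0; have ex : exists B, (D < B ^ K)%N.
  by exists D.+1; have := leq_pexp2l (ltn0Sn D) K_gt0; rewrite expn1.
case: (ex_minnP ex) => B lt_D Bmin; exists B.
have B_gt0 : (0 < B)%N by case: B lt_D {Bmin} => //; rewrite exp0n.
split=> // c1_ge1 le_D.
have [B1|B1] := leqP B 1.
  have -> : B = 1%N by lia.
  by rewrite expr1n mulr_ege1 // exprn_ege1 // ler1n.
have le_b : (B.-1 ^ K <= D)%N.
  by rewrite leqNgt; apply/negP=> /Bmin; lia.
apply: le_trans (_ : _ <= 2 ^+ K * (B.-1%:R) ^+ K) _.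
  by rewrite -exprMn lerXn2r ?nnegrE ?mulr_ge0 // -natrM ler_nat; lia.
rewrite ler_wpM2l ?exprn_ge0 // -natrX.
by apply: le_trans le_D; rewrite ler_nat.
Qed.

Lemma slog_superlinear_of_cor_exp eps (f : forall n, boolfun n) : 0 < eps ->
    (forall eta : R, 0 < eta -> \forall n \near \oo,
        Cor_deg (f n) (2 `^ (log2 n%:R `^ (1 - eta)))
          <= 2 `^ (- (eps * n%:R))) ->
  slog_superlinear R f.
Proof.
move=> eps_gt0 hcor c; pose c1 := `|c| + 1.
have c1_ge : c <= c1 by rewrite /c1; have := ler_norm c; lra.
have c1_ge1 : 1 <= c1 by rewrite /c1; have := normr_ge0 c; lra.
pose K := (Num.bound (2 * c1 / eps)).+1.
have K_gt : 2 * c1 < K%:R * eps.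
  rewrite -ltr_pdivrMr //; apply: lt_trans (archi_boundP _) _; last by rewrite ltr_nat.
  by rewrite divr_ge0 ?mulr_ge0 //; lra.
(* The height [B ^ (K - 1)] will be of order [(log n) ^ (1 - 1 / K)]. Half of the saving [1 / K] is
   kept to absorb the constant [a]. *)
pose eta : R := (2 * K%:R)^-1.
have eta_gt0 : 0 < eta by rewrite invr_gt0 mulr_gt0 // ltr0n.
pose a : R := 2 ^+ K * c1.
move: (hcor eta eta_gt0) (nbhs_infty_ge 1)
  (log2_unbounded (Num.max 1 (a ^+ (2 * K.-1)))); apply: filterS3 => n hn n_gt0.
set z := log2 n%:R in hn *; rewrite ge_max => /andP[z_ge1 z_gea].
move=> [C [Cf le_s le_d]].
have n0 : 0 < n%:R :> R by rewrite ltr0n.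
have z_ge0 : 0 <= z by lra.
have c1z : 1 <= c1 * z by rewrite mulr_ege1.
pose D := Num.truncn (c1 * z).
have le_depth : (circuit_depth C <= D)%N.
  rewrite truncn_ge_nat; last by lra.
  by apply: le_trans le_d _; rewrite ler_wpM2r.
have le_D : D%:R <= c1 * z by rewrite truncn_le; lra.
have [B [B_gt0 lt_D /(_ c1z le_D) le_B]] := valiant_base (c1 * z) D (ltn0Sn _ : (0 < K)%N).
pose T := (1 * B ^ K.-1)%N.
have le_T : T%:R <= z `^ (1 - eta).
  (* In the power [2 * K] the left side is at most [(a * z) ^ (2 * (K - 1))], and
     [a ^ (2 * (K - 1)) <= z] turns this into [z ^ (2 * K - 1)]. *)
  rewrite -(@ler_pXn2r _ (2 * K)%N) ?nnegrE ?powR_ge0 ?ler0n //.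
  rewrite -[leRHS]powR_mulrn ?powR_ge0 // -powRrM.
  have -> : (1 - eta) * (2 * K)%:R = (2 * K.-1).+1%:R.
    have K0 : K%:R != 0 :> R by rewrite pnatr_eq0.
    have Kp : K.-1%:R = K%:R - 1 :> R by apply/esym/eqP; rewrite subr_eq natr1.
    by rewrite /eta -[RHS]natr1 !natrM Kp; field.
  rewrite powR_mulrn // /T mul1n natrX.
  have -> : (B%:R ^+ K.-1) ^+ (2 * K) = (B%:R ^+ K) ^+ (2 * K.-1) :> R.
    by rewrite -!exprM; congr (_ ^+ _); rewrite mulnCA [RHS]mulnCA [(K.-1 * K)%N]mulnC.
  apply: le_trans (_ : _ <= (a * z) ^+ (2 * K.-1)) _.
    rewrite mulrA -/a in le_B.
    by rewrite lerXn2r ?nnegrE ?exprn_ge0 // (le_trans _ le_B) ?exprn_ge0.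
  by rewrite exprMn exprS ler_wpM2r ?exprn_ge0.
have le_2T : (2 ^ T)%:R <= 2 `^ (z `^ (1 - eta)) :> R.
  by rewrite natrX exprn_powR2 ler_powR // ler1n.
have lt_D' : (D < 1 * B ^ K)%N by rewrite mul1n.
have [g le_g le_n] := depth_cut Cf (ltn0Sn _) B_gt0 le_depth lt_D' (Cor_degP (f n) le_2T).
have le_eg := cut_exponent le_n hn.
have le_g' : K%:R * g%:R <= 2 * (circuit_size C)%:R :> R.
  by rewrite -!natrM ler_nat.
have : K%:R * (eps * n%:R) <= 2 * (c1 * n%:R).
  apply: le_trans (_ : _ <= K%:R * g%:R) _; first by rewrite ler_wpM2l.
  apply: le_trans le_g' _; rewrite ler_wpM2l //.
  by apply: le_trans le_s _; rewrite ler_wpM2r // ltW.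
by rewrite !mulrA ler_pM2r // leNgt K_gt.
Qed.

Lemma slog_superlinear_of_cor_poly eps (f : forall n, boolfun n) : 0 < eps ->
    (forall C : R, 0 < C -> \forall n \near \oo,
        Cor_deg (f n) (n%:R `^ eps)
          <= 2 `^ (- (C * n%:R / log2 (log2 n%:R)))) ->
  slog_superlinear R f.
Proof.
move=> eps_gt0 hcor c; pose c1 := `|c| + 1.
have c1_ge : c <= c1 by rewrite /c1; have := ler_norm c; lra.
have c1_ge1 : 1 <= c1 by rewrite /c1; have := normr_ge0 c; lra.
(* Here the base is fixed and the number of digits grows like [log log n]. *)
pose B := (Num.bound ((c1 + 1) / eps)).+2.
have B_gt : c1 + 1 <= B%:R * eps.
  rewrite -ler_pdivrMr //; apply: le_trans (ltW (archi_boundP _)) _.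
    by rewrite divr_ge0 //; lra.
  by rewrite ler_nat /B; do 2!apply: leqW.
have B_gt1 : (1 < B)%N by [].
have B1 : 1 < B%:R :> R by rewrite ltr1n.
have lB := log2_gt0 B1.
(* The cut will have at most [2 * c1 * n / K] members, while [log log n <= 2 * K * log2 B]. A
   constant above [4 * c1 * log2 B] is therefore contradictory. *)
pose C0 := 4 * c1 * log2 B%:R + 1.
have C0_gt0 : 0 < C0.
  by have : 0 <= c1 * log2 B%:R; [rewrite mulr_ge0 //; lra | rewrite /C0; lra].
move: (hcor C0 C0_gt0) (nbhs_infty_ge 1) (log2_unbounded B%:R); apply: filterS3 => n hn n_gt0.
set z := log2 n%:R in hn *; move=> z_geB [C [Cf le_s le_d]].
have n0 : 0 < n%:R :> R by rewrite ltr0n.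
have z_gt1 : 1 < z by apply: lt_le_trans z_geB.
have z_gt0 : 0 < z by apply: lt_trans z_gt1.
have c1_ge0 : 0 <= c1 by apply: le_trans c1_ge1.
pose m := Num.truncn z.
have m_geB : (B <= m)%N by rewrite truncn_ge_nat // ltW.
pose K := trunc_log B m.
have /andP[le_Km lt_mK] : (B ^ K <= m < B ^ K.+1)%N.
  by apply: trunc_log_bounds => //; apply: leq_trans m_geB.
have K_gt0 : (0 < K)%N.
  by case: (K) lt_mK => //; rewrite expn1 ltnNge m_geB.
have /andP[le_mz lt_zm] : m%:R <= z < m.+1%:R by apply/truncn_itv/ltW.
have le_Kz : (B ^ K)%:R <= z by apply: le_trans le_mz; rewrite ler_nat.
have lt_zK : z < B%:R ^+ K.+1.
  by apply: lt_le_trans lt_zm _; rewrite -natrX ler_nat.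
have c1z : 0 <= c1 * z by rewrite mulr_ge0 // ltW.
pose D := Num.truncn (c1 * z).
have le_depth : (circuit_depth C <= D)%N.
  rewrite truncn_ge_nat //.
  by apply: le_trans le_d _; rewrite ler_wpM2r // ltW.
have le_D : D%:R <= c1 * z by rewrite truncn_le.
pose X := (D %/ B ^ K).+1.
have BK_gt0 : (0 < B ^ K)%N by rewrite expn_gt0.
have lt_D : (D < X * B ^ K)%N by rewrite ltn_ceil.
pose T := (X * B ^ K.-1)%N.
(* [B * T = X * B ^ K <= D + B ^ K <= (c1 + 1) * z], and [B] was chosen with [c1 + 1 <= B * eps]. *)
have le_T : T%:R <= eps * z.
  have le_BT : (B * T <= D + B ^ K)%N.
    rewrite /T mulnCA -expnS prednK // /X mulSn addnC leq_add2r.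
    exact: leq_trunc_div.
  have : B%:R * T%:R <= (B%:R * eps) * z.
    rewrite -natrM; apply: le_trans (_ : _ <= (D + B ^ K)%:R) _; first by rewrite ler_nat.
    rewrite natrD; apply: le_trans (_ : _ <= (c1 + 1) * z) _; last by rewrite ler_wpM2r // ltW.
    by rewrite mulrDl mul1r lerD.
  by rewrite -mulrA ler_pM2l // ltr0n.
have le_2T : (2 ^ T)%:R <= n%:R `^ eps :> R.
  rewrite natrX exprn_powR2 -{1}(log2K n0) -powRrM ler_powR ?ler1n //.
  by rewrite mulrC.
have [g le_g le_n] := depth_cut Cf K_gt0 (ltnW B_gt1) le_depth lt_D (Cor_degP (f n) le_2T).
have le_eg := cut_exponent le_n hn.
have w_gt0 : 0 < log2 z by apply: log2_gt0.
have le_w : log2 z <= 2 * K%:R * log2 B%:R.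
  apply: le_trans (_ : _ <= K.+1%:R * log2 B%:R) _.
    rewrite -log2X ?ltr0n //; exact: ler_log2 (ltW lt_zK).
  by rewrite ler_wpM2r ?(ltW lB) // -natrM ler_nat mul2n -addnn -addn1 leq_add2l.
have le_g' : K%:R * g%:R <= 2 * (circuit_size C)%:R :> R.
  by rewrite -!natrM ler_nat.
have le_s' : (circuit_size C)%:R <= c1 * n%:R.
  by apply: le_trans le_s _; rewrite ler_wpM2r // ltW.
have h1 : C0 * n%:R <= g%:R * log2 z by rewrite -ler_pdivrMr.
have h2 : g%:R * log2 z <= 4 * (c1 * n%:R) * log2 B%:R.
  apply: le_trans (_ : _ <= g%:R * (2 * K%:R * log2 B%:R)) _; first by rewrite ler_wpM2l.
  rewrite mulrA ler_wpM2r ?(ltW lB) //.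
  have -> : 4 * (c1 * n%:R) = 2 * (2 * (c1 * n%:R)) by rewrite [RHS]mulrA -natrM.
  rewrite mulrCA [g%:R * _]mulrC ler_wpM2l //.
  by apply: le_trans le_g' _; rewrite ler_wpM2l.
by move: (le_trans h1 h2); rewrite /C0 mulrDl mul1r mulrA mulrAC gerDl leNgt n0.
Qed.

End Asymptotics.

Theorem theorem12 (R : realType) (eps : R) (eps_gt0 : 0 < eps) :
  (forall (n : nat) (f : boolfun n),
     Cor_deg f 16 <= 2 `^ (- (n%:R * (1 - eps))) ->
     ((39 / 10 * (1 - eps) * n%:R - 4)%:E <= min_circuit_size R f)%E)
  /\
  (forall f : forall n : nat, boolfun n,
     (forall d : nat, \forall n \near \oo,
        Cor_deg (f n) d%:R <= 2 `^ (- (eps * n%:R))) ->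
     ssp_superlinear R f)
  /\
  (forall f : forall n : nat, boolfun n,
     (forall eta : R, 0 < eta -> \forall n \near \oo,
        Cor_deg (f n) (2 `^ (log2 n%:R `^ (1 - eta)))
          <= 2 `^ (- (eps * n%:R))) ->
     slog_superlinear R f)
  /\
  (forall f : forall n : nat, boolfun n,
     (forall C : R, 0 < C -> \forall n \near \oo,
        Cor_deg (f n) (n%:R `^ eps)
          <= 2 `^ (- (C * n%:R / log2 (log2 n%:R)))) ->
     slog_superlinear R f).
Proof.
split; first by move=> n f; apply: circuit_size_of_cor16.
split; first by move=> f; apply: sp_superlinear_of_cor.
split=> f; first exact: slog_superlinear_of_cor_exp.
exact: slog_superlinear_of_cor_poly.
Qed.
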